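(* Assume that $$\sum_{n=0}^{\infty} P_n(0)^2=\infty$$ and that the Jacobi operator $J$ is positive-semidefinite. Then $J$ is self-adjoint and invertible (i.e. $0$ is not an eigenvalue of $J$, so that $J^{-1}$ exists as a possibly unbounded operator). Moreover, $J^{-1}$ belongs to the trace class if and only if $$-\sum_{n=0}^{\infty}\Bigg(\sum_{j=n}^{\infty}\frac{1}{a_jP_j(0)P_{j+1}(0)}\Bigg)P_n(0)^2<\infty .$$ If so, then $\operatorname{Tr}(J^{-1})$ equals the left-hand side of this inequality (including the sign).
   Context: $\mathbb{N}_0=\{0,1,2,\dots\}$. Let $(a_n)_{n\in\mathbb{N}_0}$ be a sequence of positive numbers and $(b_n)_{n\in\mathbb{N}_0}$ a sequence of real numbers. Let $\mathcal{J}$ be the infinite symmetric tridiagonal (Jacobi) matrix with diagonal entries $b_0,b_1,\dots$ and off-diagonal entries $a_0,a_1,\dots$ ($\mathcal{J}_{n,n}=b_n$, $\mathcal{J}_{n,n+1}=\mathcal{J}_{n+1,n}=a_n$). The Jacobi operator $J$ is the closure in $\ell^2(\mathbb{N}_0)$ of the action of $\mathcal{J}$ on finitely supported sequences. $J$ is positive-semidefinite if $\langle x,Jx\rangle\ge 0$ for all $x\in\operatorname{Dom}(J)$. The polynomials $(P_n)_{n\ge0}$ are defined by $P_0\equiv1$, $P_1(z)=(z-b_0)/a_0$, and $zP_n(z)=a_{n-1}P_{n-1}(z)+b_nP_n(z)+a_nP_{n+1}(z)$ for $n\ge1$. (Under the assumptions of the claim, $P_n(0)\neq 0$ and $P_j(0)P_{j+1}(0)<0$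 for all indices, so all sums are well defined in $[0,\infty]$ after including the minus sign.) *)

(* Defs.v *)
From HB Require Import structures.
From mathcomp Require Import all_boot all_order all_algebra.
From mathcomp Require Import all_classical all_reals all_analysis.
From mathcomp Require Import complex.

Set Implicit Arguments.
Unset Strict Implicit.
Unset Printing Implicit Defensive.

Import Order.TTheory GRing.Theory Num.Theory.
Import numFieldNormedType.Exports.

Local Open Scope classical_set_scope.
Local Open Scope ring_scope.

(* The complex Hilbert space l^2(N): sequences x : nat -> R[i] satisfying
   [l2 x].  The norm takes values in [0, +oo], so that convergence in norm and
   norm inequalities carry no junk values outside l^2. *)
Section HilbertSpace.
Variable R : realType.
Local Notation cseq := (nat -> R[i]).

Definition l2norm (x : cseq) : \bar R :=
  sqrte (\sum_(n <oo) ((complex.Re (x n) ^+ 2 + complex.Im (x n) ^+ 2)%:E))%E.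

Definition l2 : set cseq := [set x | (l2norm x < +oo)%E].

Definition l2cvg (u : nat -> cseq) (x : cseq) : Prop :=
  l2norm (fun n => u k n - x n) @[k --> \oo] --> 0%E.

(* Sum of a convergent complex series, taken on real and imaginary parts. *)
Definition cseries_cvg (u : cseq) (s : R[i]) : Prop :=
  (\sum_(0 <= n < N) complex.Re (u n)) @[N --> \oo] --> complex.Re s /\
  (\sum_(0 <= n < N) complex.Im (u n)) @[N --> \oo] --> complex.Im s.

Definition csum (u : cseq) : R[i] :=
  Complex (limn (fun N => \sum_(0 <= n < N) complex.Re (u n)))
          (limn (fun N => \sum_(0 <= n < N) complex.Im (u n))).

(* Conjugate-linear in the first argument. *)
Definition inner (x y : cseq) : R[i] := csum (fun n => conjc (x n) * y n).

Definition orthonormal_basis (f : nat -> cseq) : Prop :=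
  [/\ forall n, l2 (f n),
      forall m n, inner (f m) (f n) = (m == n)%:R &
      forall x, l2 x ->
        l2cvg (fun N k => \sum_(0 <= n < N) inner (f n) x * f n k) x].

(* Possibly unbounded operators are represented by their graphs; a pair (x, y)
   belongs to the graph when x is in the domain and is mapped to y. *)
Definition graph := set (cseq * cseq).

Definition dom (G : graph) : set cseq := [set x | exists y, G (x, y)].

Definition graph_closure (G : graph) : graph :=
  [set p | [/\ l2 p.1, l2 p.2 & exists u v : nat -> cseq,
     [/\ forall k, G (u k, v k), l2cvg u p.1 & l2cvg v p.2]]].

Definition graph_inverse (G : graph) : graph := [set p | G (p.2, p.1)].

Definition graph_adjoint (G : graph) : graph :=
  [set p | [/\ l2 p.1, l2 p.2 &
     forall x y, G (x, y) -> inner p.1 y = inner p.2 x]].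

Definition densely_defined (G : graph) : Prop :=
  forall x, l2 x ->
    exists u : nat -> cseq, (forall k, dom G (u k)) /\ l2cvg u x.

Definition self_adjoint (G : graph) : Prop :=
  densely_defined G /\ graph_adjoint G = G.

(* The order on R[i] makes [0 <= z] mean that z is real and nonnegative. *)
Definition positive_semidefinite (G : graph) : Prop :=
  forall x y, G (x, y) -> 0 <= inner x y.

Definition eigenvalue (G : graph) (lambda : R[i]) : Prop :=
  exists2 x : cseq, x <> (fun=> 0) & G (x, fun n => lambda * x n).

Definition invertible (G : graph) : Prop := ~ eigenvalue G 0.

Definition graph_of (T : cseq -> cseq) : graph :=
  [set p | l2 p.1 /\ p.2 = T p.1].

(* Bounded everywhere defined linear operators; values outside l^2 are
   irrelevant. *)
Definition bounded_operator (T : cseq -> cseq) : Prop :=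
  [/\ forall x, l2 x -> l2 (T x),
      forall (c : R[i]) x y, l2 x -> l2 y ->
        T (fun n => c * x n + y n) = (fun n => c * T x n + T y n) &
      exists M : R, forall x, l2 x -> (l2norm (T x) <= M%:E * l2norm x)%E].

Definition is_adjoint (T T' : cseq -> cseq) : Prop :=
  bounded_operator T' /\
  forall x y, l2 x -> l2 y -> inner (T' x) y = inner x (T y).

(* A is the absolute value |T|, the nonnegative square root of T* T. *)
Definition is_abs (T A : cseq -> cseq) : Prop :=
  [/\ bounded_operator A,
      forall x, l2 x -> 0 <= inner x (A x) &
      exists2 T', is_adjoint T T' & forall x, l2 x -> A (A x) = T' (T x)].

Definition trace_class (G : graph) : Prop :=
  exists T A : cseq -> cseq,
    [/\ G = graph_of T, bounded_operator T, is_abs T A &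
        forall f, orthonormal_basis f ->
          (\sum_(n <oo) (complex.Re (inner (f n) (A (f n))))%:E < +oo)%E].

Definition has_trace (G : graph) (t : R[i]) : Prop :=
  exists T : cseq -> cseq,
    [/\ G = graph_of T, bounded_operator T &
        forall f, orthonormal_basis f ->
          cseries_cvg (fun n => inner (f n) (T (f n))) t].

End HilbertSpace.

Section Jacobi.
Variables (R : realType) (a b : nat -> R).

Definition jacobi_matrix (m n : nat) : R :=
  if n == m then b m
  else if n == m.+1 then a m
  else if m == n.+1 then a n
  else 0.

(* Row m of the matrix vanishes beyond column m.+1, so the sum is the full
   matrix-vector product. *)
Definition jacobi_action (x : nat -> R[i]) (m : nat) : R[i] :=
  \sum_(0 <= n < m.+2) real_complex R (jacobi_matrix m n) * x n.

Definition finitely_supported (x : nat -> R[i]) : Prop :=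
  exists N, forall n, (N <= n)%N -> x n = 0.

Definition jacobi_operator : graph R :=
  graph_closure [set p | finitely_supported p.1 /\ p.2 = jacobi_action p.1].

Fixpoint jacobi_poly (n : nat) : {poly R} :=
  if n is n'.+1 then
    if n' is m.+1 then
      (a n')^-1 *: (('X - (b n')%:P) * jacobi_poly n' - a m *: jacobi_poly m)
    else (a 0)^-1 *: ('X - (b 0)%:P)
  else 1.

Definition jacobi_poly0 (n : nat) : R := (jacobi_poly n).[0].

(* Under the assumptions of the theorem every summand of the inner series is
   negative, so each of the two series has a value in [-oo, 0]. *)
Definition inverse_trace_series : \bar R :=
  (- \sum_(0 <= n <oo)
      ((\sum_(n <= j <oo)
          (1 / (a j * jacobi_poly0 j * jacobi_poly0 j.+1))%:E)
       * (jacobi_poly0 n ^+ 2)%:E))%E.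

End Jacobi.

(* Main.v *)
Require Import Defs.
From mathcomp Require Import all_boot all_order all_algebra.
From mathcomp Require Import all_classical all_reals all_analysis.
From mathcomp Require Import complex ring lra.

(* Write [Q n] for [P_n(0)].  Positivity of [J] on the truncations of [Q] forces
   [Q n * Q n.+1 < 0], so the weights [w j = - 1 / (a j * Q j * Q j.+1)] are
   positive, and [J] maps [w j] times [Q] truncated after [j] to
   [delta j / Q j - delta j.+1 / Q j.+1].  Hence a finitely supported [y] is the
   image under the matrix of a finitely supported vector as soon as
   [\sum_n Q n * y n = 0]; since [Q] is not in l^2, such [y] are dense.

   Self-adjointness: the same density holds for [J + 1], whose polynomials at
   [0] dominate [Q] in absolute value (a Wronskian that grows with the diagonal).
   As [J + 1 >= 1], this gives [|p| <= |(J + 1) p|] for every [p] in the maximal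
   domain, and then approximation of [(J + 1) p] by images of finitely supported
   vectors shows that [p] lies in the domain of the closure.

   Trace: the candidate inverse is the sum of the positive rank-one operators
   [w j * v_j <v_j, .>] with [v_j] the truncation of [Q] after [j]; its kernel is
   [Q m * Q n * \sum_(j >= max m n) w j], and by Parseval and Tonelli its trace in
   any orthonormal basis is [\sum_j w j * |v_j|^2], the series of the theorem.
   Conversely, if [J^-1 = T] is of trace class with [A = |T|], then [T <= A], and
   positivity of [J] bounds [<delta n, T (delta n)>] below by the [n]-th term. *)

Set Implicit Arguments.
Unset Strict Implicit.
Unset Printing Implicit Defensive.

Import Order.TTheory GRing.Theory Num.Theory.
Import numFieldNormedType.Exports.

Local Open Scope classical_set_scope.
Local Open Scope ring_scope.

(* [inner] is a pair of limits; unfolding it would expose the pair under [conjc]. *)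
#[local] Arguments inner : simpl never.

(** * The sequence space *)

Section L2.
Variable R : realType.
Local Notation cseq := (nat -> R[i]).
Local Notation Re := (@complex.Re R).
Local Notation Im := (@complex.Im R).
Implicit Types (x y z : cseq) (c : R[i]).

Definition sqmod c : R := Re c ^+ 2 + Im c ^+ 2.

(** The limit is a default value when the series diverges, so [sqnorm] has a meaning only for
    sequences in [l2]. *)
Definition sqnorm x : R := limn (fun N => \sum_(0 <= n < N) sqmod (x n)).

Lemma cReD c d : Re (c + d) = Re c + Re d. Proof. by case: c; case: d. Qed.
Lemma cImD c d : Im (c + d) = Im c + Im d. Proof. by case: c; case: d. Qed.
Lemma cReM c d : Re (c * d) = Re c * Re d - Im c * Im d.
Proof. by case: c; case: d. Qed.
Lemma cImM c d : Im (c * d) = Re c * Im d + Im c * Re d.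
Proof. by case: c; case: d. Qed.
Lemma cReN c : Re (- c) = - Re c. Proof. by case: c. Qed.
Lemma cImN c : Im (- c) = - Im c. Proof. by case: c. Qed.
Lemma cReJ c : Re (conjc c) = Re c. Proof. by case: c. Qed.
Lemma cImJ c : Im (conjc c) = - Im c. Proof. by case: c. Qed.

Lemma conjcD c d : conjc (c + d) = conjc c + conjc d. Proof. exact: rmorphD. Qed.
Lemma conjcM c d : conjc (c * d) = conjc c * conjc d. Proof. exact: rmorphM. Qed.
Lemma conjcN c : conjc (- c) = - conjc c. Proof. exact: rmorphN. Qed.

Definition cReImE := (cReD, cImD, cReM, cImM, cReN, cImN, cReJ, cImJ).

Lemma complex_eq c d : Re c = Re d -> Im c = Im d -> c = d.
Proof. by case: c => a b; case: d => a' b' /= -> ->. Qed.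

Lemma cRe_conjM c : Re (conjc c * c) = sqmod c.
Proof. by rewrite /sqmod !cReImE; ring. Qed.

Lemma sqmod_ge0 c : 0 <= sqmod c.
Proof. by rewrite addr_ge0 ?sqr_ge0. Qed.

Lemma sqmod0 : sqmod 0 = 0.
Proof. by rewrite /sqmod /= expr0n addr0. Qed.

Lemma sqmodM c d : sqmod (c * d) = sqmod c * sqmod d.
Proof. by rewrite /sqmod !cReImE; ring. Qed.

Lemma sqmodN c : sqmod (- c) = sqmod c.
Proof. by rewrite /sqmod !cReImE !sqrrN. Qed.

Lemma sqmodJ c : sqmod (conjc c) = sqmod c.
Proof. by rewrite /sqmod !cReImE !sqrrN. Qed.

Lemma sqmodR (r : R) : sqmod r%:C%C = r ^+ 2.
Proof. by rewrite /sqmod /= expr0n addr0. Qed.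

Lemma sqmod_eq0 c : sqmod c = 0 -> c = 0.
Proof.
move=> /eqP; rewrite paddr_eq0 ?sqr_ge0// !sqrf_eq0 => /andP[/eqP r0 /eqP i0].
exact: complex_eq.
Qed.

Lemma sqmodD_le c d : sqmod (c + d) <= 2 * sqmod c + 2 * sqmod d.
Proof.
rewrite /sqmod !cReImE.
have := sqr_ge0 (Re c - Re d); have := sqr_ge0 (Im c - Im d).
rewrite !expr2; lra.
Qed.

Lemma sum_sqmod_nd x : nondecreasing_seq (fun N => \sum_(0 <= n < N) sqmod (x n)).
Proof.
apply/nondecreasing_seqP => n.
by rewrite big_nat_recr//= lerDl sqmod_ge0.
Qed.

(** Trades finiteness in the extended reals for a real bound on partial sums, the form in which
    membership in [l2] is verified from here on. *)
Lemma l2_boundedP x :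
  l2 x <-> exists M, forall N, \sum_(0 <= n < N) sqmod (x n) <= M.
Proof.
rewrite /l2 /l2norm /=; split.
- have : (0 <= \sum_(n <oo) (sqmod (x n))%:E)%E.
    by apply: nneseries_ge0 => *; rewrite lee_fin sqmod_ge0.
  move=> s0 h; have {}h : (\sum_(n <oo) (sqmod (x n))%:E < +oo)%E.
    move: h; rewrite -/(sqmod _); case: (\sum_(n <oo) _)%E s0 => //=.
    by move=> r _ _; rewrite ltry.
  exists (fine (\sum_(n <oo) (sqmod (x n))%:E)) => N.
  rewrite -lee_fin fineK; last by rewrite ge0_fin_numE.
  rewrite -sumEFin; apply: nneseries_lim_ge => *.
  by rewrite lee_fin sqmod_ge0.
- move=> [M hM].
  have : (\sum_(n <oo) (sqmod (x n))%:E <= M%:E)%E.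
    apply: lime_le.
      by apply: is_cvg_nneseries => *; rewrite lee_fin sqmod_ge0.
    by apply: nearW => N /=; rewrite sumEFin lee_fin.
  rewrite -/(sqmod _).
  case: (\sum_(n <oo) _)%E => //= r _; exact: ltry.
Qed.

Lemma sqnorm_cvg x : l2 x ->
  (\sum_(0 <= n < N) sqmod (x n)) @[N --> \oo] --> sqnorm x.
Proof.
move=> /l2_boundedP[M hM].
apply: (@nondecreasing_is_cvgn _ (fun N => \sum_(0 <= n < N) sqmod (x n))).
  exact: sum_sqmod_nd.
by exists M => _ [N _ <-].
Qed.

Lemma sqnorm_ge x N : l2 x -> \sum_(0 <= n < N) sqmod (x n) <= sqnorm x.
Proof.
move=> lx; apply: (nondecreasing_cvgn_le (sum_sqmod_nd x)).
by apply/cvg_ex; exists (sqnorm x); exact: sqnorm_cvg.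
Qed.

Lemma sqnorm_ge0 x : l2 x -> 0 <= sqnorm x.
Proof. by move=> lx; have := sqnorm_ge 0 lx; rewrite big_geq. Qed.

Lemma sqmod_le_sqnorm x n : l2 x -> sqmod (x n) <= sqnorm x.
Proof.
move=> lx; apply: le_trans (sqnorm_ge n.+1 lx).
rewrite big_nat_recr//= lerDr sumr_ge0// => *; exact: sqmod_ge0.
Qed.

Lemma l2_le x M : (forall N, \sum_(0 <= n < N) sqmod (x n) <= M) ->
  l2 x /\ sqnorm x <= M.
Proof.
move=> h; have lx : l2 x by apply/l2_boundedP; exists M.
split=> //; apply: limr_le.
  by apply/cvg_ex; exists (sqnorm x); exact: sqnorm_cvg.
exact: nearW.
Qed.

Lemma l2normE x : l2 x -> l2norm x = (Num.sqrt (sqnorm x))%:E.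
Proof.
move=> lx; rewrite /l2norm.
suff -> : (\sum_(n <oo) (Re (x n) ^+ 2 + Im (x n) ^+ 2)%:E)%E = (sqnorm x)%:E.
  by [].
rewrite /sqnorm -EFin_lim; last by apply/cvg_ex; exists (sqnorm x); exact: sqnorm_cvg.
by congr (limn _); apply/funext => N /=; rewrite sumEFin.
Qed.

Lemma sqnorm_eq0 x : l2 x -> sqnorm x = 0 -> x = (fun=> 0).
Proof.
move=> lx x0; apply/funext => n; apply/sqmod_eq0/eqP.
by rewrite eq_le sqmod_ge0 -x0 sqmod_le_sqnorm.
Qed.

Lemma l2D x y : l2 x -> l2 y -> l2 (x + y).
Proof.
move=> lx ly; apply/l2_boundedP; exists (2 * sqnorm x + 2 * sqnorm y) => N.
apply: le_trans (_ : \sum_(0 <= n < N) (2 * sqmod (x n) + 2 * sqmod (y n)) <= _).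
  by apply: ler_sum => n _; exact: sqmodD_le.
by rewrite big_split/= -!mulr_sumr lerD// ler_pM2l// sqnorm_ge.
Qed.

Lemma l2Z c x : l2 x -> l2 (fun n => c * x n).
Proof.
move=> lx; apply/l2_boundedP; exists (sqmod c * sqnorm x) => N.
under eq_bigr do rewrite sqmodM.
by rewrite -mulr_sumr ler_wpM2l ?sqmod_ge0// sqnorm_ge.
Qed.

Lemma l2N x : l2 x -> l2 (- x).
Proof.
move=> lx; apply/l2_boundedP; exists (sqnorm x) => N.
under eq_bigr do rewrite sqmodN.
exact: sqnorm_ge.
Qed.

Lemma l2B x y : l2 x -> l2 y -> l2 (x - y).
Proof. by move=> lx ly; apply: l2D => //; exact: l2N. Qed.

Lemma sqnormE x N : (forall n, (N <= n)%N -> x n = 0) ->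
  l2 x /\ sqnorm x = \sum_(0 <= n < N) sqmod (x n).
Proof.
move=> x0.
have E M : (N <= M)%N -> \sum_(0 <= n < M) sqmod (x n) = \sum_(0 <= n < N) sqmod (x n).
  move=> NM; rewrite (@big_cat_nat _ _ _ N)//=.
  rewrite [X in _ + X]big_nat_cond [X in _ + X]big1 ?addr0//.
  by move=> i /andP[/andP[Ni _] _]; rewrite x0// sqmod0.
have lx : l2 x.
  apply/l2_boundedP; exists (\sum_(0 <= n < N) sqmod (x n)) => M.
  have [/E ->//|/ltnW MN] := leqP N M.
  exact: (sum_sqmod_nd x MN).
split=> //; apply/cvg_lim => //.
apply: cvg_near_cst; exists N => // M /= NM; exact/esym/E.
Qed.

Lemma l2_finitely_supported x : finitely_supported x -> l2 x.
Proof. by move=> [N /sqnormE[]]. Qed.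

End L2.

(** * Inner product, Cauchy-Schwarz and the real-valued norm *)

Section Inner.
Variable R : realType.
Local Notation cseq := (nat -> R[i]).
Local Notation Re := (@complex.Re R).
Local Notation Im := (@complex.Im R).
Implicit Types (x y z : cseq) (c : R[i]).

(** Evaluate at the minimiser [- B / X]. Admitting [X = 0] makes the lemma serve forms that are only
    semidefinite. *)
Lemma quadratic_ge0_discr (X B Y : R) : 0 <= X ->
  (forall t, 0 <= X * t ^+ 2 + 2 * B * t + Y) -> B ^+ 2 <= X * Y.
Proof.
rewrite le_eqVlt => /orP[/eqP<- h|X0 h]; last first.
  have := h (- B / X) => /(mulr_ge0 (ltW X0)).
  suff -> : X * (X * (- B / X) ^+ 2 + 2 * B * (- B / X) + Y) = X * Y - B ^+ 2.
    by rewrite subr_ge0.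
  by field; rewrite gt_eqF.
rewrite mul0r; have [->|B0] := eqVneq B 0; first by rewrite expr0n.
(* With [X = 0] the polynomial is affine of slope [2 * B]; this is the point where it equals -1. *)
have := h (- (Y + 1) / (2 * B)).
have -> : 0 * (- (Y + 1) / (2 * B)) ^+ 2 + 2 * B * (- (Y + 1) / (2 * B)) + Y = -1.
  by field.
lra.
Qed.

Lemma dominated_sum_cvg (f g : nat -> R) (M : R) :
  (forall n, `|f n| <= g n) -> (forall N, \sum_(0 <= n < N) g n <= M) ->
  cvgn (fun N => \sum_(0 <= n < N) f n).
Proof.
move=> fg gM; apply: (@normed_cvg _ R f).
apply: nondecreasing_is_cvgn.
  apply/nondecreasing_seqP => n.
  rewrite -[leRHS]/(\sum_(0 <= k < n.+1) `|f k|) big_nat_recr//= lerDl.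
  exact: normr_ge0.
exists M => _ [N _ <-]; apply: le_trans (gM N).
by apply: ler_sum => i _; exact: fg.
Qed.

Lemma cseqD x y n : (x + y) n = x n + y n. Proof. by []. Qed.
Lemma cseqN x n : (- x) n = - x n. Proof. by []. Qed.

Lemma csum_eq (u : cseq) s : cseries_cvg u s -> csum u = s.
Proof.
by move=> [ur ui]; apply: complex_eq => /=; apply/cvg_lim.
Qed.

Lemma cseries_cvgD (u v : cseq) s t :
  cseries_cvg u s -> cseries_cvg v t -> cseries_cvg (u + v) (s + t).
Proof.
move=> [ur ui] [vr vi]; split.
- under eq_fun do under eq_bigr do rewrite cReD.
  by under eq_fun do rewrite big_split; rewrite cReD; exact: cvgD.
- under eq_fun do under eq_bigr do rewrite cImD.
  by under eq_fun do rewrite big_split; rewrite cImD; exact: cvgD.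
Qed.

(** Convertible to the bare scalar multiples in the definitions of linearity, but with a head symbol
    that rewriting can match. *)
Definition scale_seq c x : cseq := fun n => c * x n.

Lemma l2_scale_seq c x : l2 x -> l2 (scale_seq c x).
Proof. exact: l2Z. Qed.

Lemma cseries_cvgZ c (u : cseq) s :
  cseries_cvg u s -> cseries_cvg (scale_seq c u) (c * s).
Proof.
move=> [ur ui]; split; rewrite /scale_seq.
- under eq_fun do under eq_bigr do rewrite cReM.
  under eq_fun do rewrite sumrB -!mulr_sumr.
  by rewrite cReM; apply: cvgB; exact: cvgMr.
- under eq_fun do under eq_bigr do rewrite cImM.
  under eq_fun do rewrite big_split/= -!mulr_sumr.
  by rewrite cImM; apply: cvgD; exact: cvgMr.
Qed.

Lemma cseries_cvgJ (u : cseq) s :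
  cseries_cvg u s -> cseries_cvg (fun n => conjc (u n)) (conjc s).
Proof.
move=> [ur ui]; split.
- by under eq_fun do under eq_bigr do rewrite cReJ; rewrite cReJ.
- under eq_fun do under eq_bigr do rewrite cImJ.
  by under eq_fun do rewrite sumrN; rewrite cImJ; exact: cvgN.
Qed.

Lemma cseries_cvg_finite (u : cseq) N : (forall n, (N <= n)%N -> u n = 0) ->
  cseries_cvg u (\sum_(0 <= n < N) u n).
Proof.
move=> u0.
have E M : (N <= M)%N -> \sum_(0 <= n < M) u n = \sum_(0 <= n < N) u n.
  move=> NM; rewrite (@big_cat_nat _ _ _ N)//=.
  rewrite [X in _ + X]big_nat_cond [X in _ + X]big1 ?addr0//.
  by move=> i /andP[/andP[Ni _] _]; rewrite u0.
have sRe M : \sum_(0 <= n < M) Re (u n) = Re (\sum_(0 <= n < M) u n).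
  by elim: M => [|M IH]; [rewrite !big_geq|rewrite !big_nat_recr//= cReD IH].
have sIm M : \sum_(0 <= n < M) Im (u n) = Im (\sum_(0 <= n < M) u n).
  by elim: M => [|M IH]; [rewrite !big_geq|rewrite !big_nat_recr//= cImD IH].
split; apply: cvg_near_cst; exists N => // M /= NM.
- by rewrite sRe E.
- by rewrite sIm E.
Qed.

(** Both parts of [conjc (x n) * y n] are dominated by [sqmod (x n) + sqmod (y n)], so both series
    converge absolutely. All algebraic rules for [inner] rest on this. *)
Lemma inner_cvg x y : l2 x -> l2 y ->
  cseries_cvg (fun n => conjc (x n) * y n) (inner x y).
Proof.
move=> lx ly.
have bd : forall N, \sum_(0 <= n < N) (sqmod (x n) + sqmod (y n)) <= sqnorm x + sqnorm y.
  by move=> N; rewrite big_split/= lerD// sqnorm_ge.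
have hlf (p q r s : R) : `|p * r + q * s| <= p ^+ 2 + q ^+ 2 + (r ^+ 2 + s ^+ 2).
  rewrite ler_norml; apply/andP; split.
  - have := sqr_ge0 (p + r); have := sqr_ge0 (q + s).
    have := sqr_ge0 p; have := sqr_ge0 q; have := sqr_ge0 r; have := sqr_ge0 s.
    rewrite !expr2; lra.
  - have := sqr_ge0 (p - r); have := sqr_ge0 (q - s).
    have := sqr_ge0 p; have := sqr_ge0 q; have := sqr_ge0 r; have := sqr_ge0 s.
    rewrite !expr2; lra.
split => /=.
- apply: (dominated_sum_cvg _ bd) => n.
  rewrite !cReImE mulNr opprK; exact: hlf.
- apply: (dominated_sum_cvg _ bd) => n.
  rewrite !cReImE [sqmod (y n)]addrC -[X in _ <= sqmod _ + (_ + X)]sqrrN.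
  rewrite mulNr -mulrN.
  exact: hlf.
Qed.

Lemma innerDr x y z : l2 x -> l2 y -> l2 z ->
  inner x (y + z) = inner x y + inner x z.
Proof.
move=> lx ly lz; apply: csum_eq.
have := cseries_cvgD (inner_cvg lx ly) (inner_cvg lx lz).
by congr cseries_cvg; apply/funext => n; rewrite -mulrDr.
Qed.

Lemma innerZr c x y : l2 x -> l2 y -> inner x (scale_seq c y) = c * inner x y.
Proof.
move=> lx ly; apply: csum_eq.
have := cseries_cvgZ c (inner_cvg lx ly).
by congr cseries_cvg; apply/funext => n; rewrite /scale_seq mulrCA.
Qed.

Lemma innerJ x y : l2 x -> l2 y -> inner y x = conjc (inner x y).
Proof.
move=> lx ly; apply: csum_eq.
have := cseries_cvgJ (inner_cvg lx ly).
by congr cseries_cvg; apply/funext => n; rewrite conjcM conjcK mulrC.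
Qed.

Lemma scale_seqN1 x : scale_seq (-1) x = - x.
Proof. by apply/funext => n; rewrite /scale_seq mulN1r. Qed.

Lemma innerNr x y : l2 x -> l2 y -> inner x (- y) = - inner x y.
Proof. by move=> lx ly; rewrite -scale_seqN1 innerZr// mulN1r. Qed.

Lemma innerBr x y z : l2 x -> l2 y -> l2 z ->
  inner x (y - z) = inner x y - inner x z.
Proof. by move=> *; rewrite innerDr ?innerNr//; exact: l2N. Qed.

Lemma innerDl x y z : l2 x -> l2 y -> l2 z ->
  inner (x + y) z = inner x z + inner y z.
Proof.
move=> lx ly lz.
by rewrite (innerJ lz (l2D lx ly)) innerDr// conjcD -(innerJ lz lx) -(innerJ lz ly).
Qed.

Lemma innerZl c x y : l2 x -> l2 y -> inner (scale_seq c x) y = conjc c * inner x y.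
Proof.
move=> lx ly.
by rewrite (innerJ ly (l2_scale_seq c lx)) innerZr// conjcM -innerJ.
Qed.

Lemma innerNl x y : l2 x -> l2 y -> inner (- x) y = - inner x y.
Proof.
by move=> lx ly; rewrite (innerJ ly (l2N lx)) innerNr// conjcN -innerJ.
Qed.

Lemma innerBl x y z : l2 x -> l2 y -> l2 z ->
  inner (x - y) z = inner x z - inner y z.
Proof. by move=> *; rewrite innerDl ?innerNl//; exact: l2N. Qed.

Lemma innerxx x : l2 x -> inner x x = (sqnorm x)%:C%C.
Proof.
move=> lx; apply: csum_eq; split => /=.
- suff -> : (fun N => \sum_(0 <= n < N) Re (conjc (x n) * x n)) =
      (fun N => \sum_(0 <= n < N) sqmod (x n)) by exact: sqnorm_cvg.
  apply/funext => N; apply: eq_bigr => n _; rewrite /sqmod !cReImE; ring.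
- suff -> : (fun N => \sum_(0 <= n < N) Im (conjc (x n) * x n)) = (fun=> 0).
    exact: cvg_cst.
  by apply/funext => N; apply: big1 => n _; rewrite !cReImE; ring.
Qed.

Lemma sqnorm_inner x : l2 x -> sqnorm x = Re (inner x x).
Proof. by move=> lx; rewrite innerxx. Qed.

Lemma sqnormD x y : l2 x -> l2 y ->
  sqnorm (x + y) = sqnorm x + 2 * Re (inner x y) + sqnorm y.
Proof.
move=> lx ly; have lxy := l2D lx ly.
rewrite (sqnorm_inner lxy) innerDr// !innerDl// !cReD (innerJ lx ly) cReJ.
rewrite -!sqnorm_inner//; move: (Re _) (sqnorm x) (sqnorm y) => p q r; ring.
Qed.

Lemma sqnormZ c x : l2 x -> sqnorm (scale_seq c x) = sqmod c * sqnorm x.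
Proof.
move=> lx; have lcx : l2 (scale_seq c x) by exact: l2_scale_seq.
rewrite (sqnorm_inner lcx) innerZr// innerZl// innerxx// /sqmod !cReImE/=.
ring.
Qed.

Lemma sqnormN x : l2 x -> sqnorm (- x) = sqnorm x.
Proof.
by move=> lx; rewrite -scale_seqN1 sqnormZ// /sqmod !cReImE/=; ring.
Qed.

Lemma sqnorm0 : sqnorm (fun=> 0 : R[i]) = 0 /\ l2 (fun=> 0 : R[i]).
Proof.
have [] := @sqnormE R (fun=> 0) 0 (fun=> fun=> erefl).
by move=> h ->; rewrite big_geq.
Qed.

Lemma Re_inner_le x y : l2 x -> l2 y -> Re (inner x y) ^+ 2 <= sqnorm x * sqnorm y.
Proof.
move=> lx ly; apply: quadratic_ge0_discr => [|t]; first exact: sqnorm_ge0.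
have lt : l2 (scale_seq t%:C%C x) by exact: l2_scale_seq.
have := sqnorm_ge0 (l2D lt ly).
rewrite sqnormD// sqnormZ// innerZl// sqmodR !cReImE/=.
by congr (_ <= _); ring.
Qed.

(** Apply the inequality for real parts to [x] multiplied by [c := inner x y]: the inner product
    becomes the real number [sqmod c], and one factor [sqmod c] cancels. *)
Lemma sqmod_inner_le x y : l2 x -> l2 y ->
  sqmod (inner x y) <= sqnorm x * sqnorm y.
Proof.
move=> lx ly; set c := inner x y.
have [c0|c0] := eqVneq (sqmod c) 0.
  by rewrite c0 mulr_ge0 ?sqnorm_ge0.
have lcx : l2 (scale_seq c x) by exact: l2_scale_seq.
have := Re_inner_le lcx ly; rewrite innerZl// -/c cRe_conjM sqnormZ// -mulrA expr2 ler_pM2l//.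
by rewrite lt_neqAle eq_sym c0 sqmod_ge0.
Qed.

Definition norm2 x : R := Num.sqrt (sqnorm x).

Lemma norm2_ge0 x : 0 <= norm2 x.
Proof. exact: sqrtr_ge0. Qed.

Lemma norm2_sq x : l2 x -> norm2 x ^+ 2 = sqnorm x.
Proof. by move=> lx; rewrite sqr_sqrtr// sqnorm_ge0. Qed.

Lemma norm2_le x r : l2 x -> 0 <= r -> (norm2 x <= r) = (sqnorm x <= r ^+ 2).
Proof.
by move=> lx r0; rewrite -norm2_sq// ler_sqr// nnegrE norm2_ge0.
Qed.

Lemma norm_Re_inner x y : l2 x -> l2 y -> `|Re (inner x y)| <= norm2 x * norm2 y.
Proof.
move=> lx ly; rewrite -sqrtr_sqr -sqrtrM ?sqnorm_ge0//.
by rewrite ler_wsqrtr// Re_inner_le.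
Qed.

Lemma norm2D x y : l2 x -> l2 y -> norm2 (x + y) <= norm2 x + norm2 y.
Proof.
move=> lx ly; rewrite norm2_le ?addr_ge0 ?norm2_ge0//; last exact: l2D.
rewrite sqnormD// -!norm2_sq// sqrrD lerD2r lerD2l.
have := le_trans (ler_norm _) (norm_Re_inner lx ly); lra.
Qed.

Lemma norm2Z c x : l2 x -> norm2 (scale_seq c x) = Num.sqrt (sqmod c) * norm2 x.
Proof. by move=> lx; rewrite /norm2 sqnormZ// sqrtrM// sqmod_ge0. Qed.

Lemma norm2N x : l2 x -> norm2 (- x) = norm2 x.
Proof. by move=> lx; rewrite /norm2 sqnormN. Qed.

Lemma l2cvgP (u : nat -> cseq) x : (forall k, l2 (u k)) -> l2 x ->
  l2cvg u x <-> norm2 (u k - x) @[k --> \oo] --> 0.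
Proof.
move=> lu lx; rewrite /l2cvg.
have -> : (fun k => l2norm (fun n => u k n - x n)) = EFin \o (fun k => norm2 (u k - x)).
  by apply/funext => k /=; rewrite -[LHS]/(l2norm (u k - x)) l2normE//; exact: l2B.
split => h.
  exact: (@fine_cvg _ _ _ _ (fun k => (norm2 (u k - x))%:E) 0 h).
by apply: cvg_EFin; [exact: nearW|exact: h].
Qed.

End Inner.

(** * Unit vectors, truncations and limits of inner products *)

Section Truncation.
Variable R : realType.
Local Notation cseq := (nat -> R[i]).
Implicit Types (x y z : cseq) (c : R[i]).

Lemma inner_finite x y N : (forall n, (N <= n)%N -> x n = 0) ->
  inner x y = \sum_(0 <= n < N) conjc (x n) * y n.
Proof.
move=> x0; apply/csum_eq/cseries_cvg_finite => n /x0 ->.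
by rewrite conjc0 mul0r.
Qed.

Definition delta (n : nat) : cseq := fun m => (m == n)%:R.

Lemma delta_finitely_supported n : finitely_supported (delta n).
Proof. by exists n.+1 => m nm; rewrite /delta gtn_eqF. Qed.

Lemma l2_delta n : l2 (delta n).
Proof. exact/l2_finitely_supported/delta_finitely_supported. Qed.

Lemma inner_deltal n x : inner (delta n) x = x n.
Proof.
rewrite (@inner_finite _ _ n.+1); last by move=> m nm; rewrite /delta gtn_eqF.
rewrite big_nat_recr//= [X in X + _]big_nat_cond big1 ?add0r.
  by rewrite /delta eqxx conjc1 mul1r.
by move=> i /andP[/andP[_ ilt] _]; rewrite /delta ltn_eqF// conjc0 mul0r.
Qed.

Lemma inner_deltar n x : l2 x -> inner x (delta n) = conjc (x n).
Proof. by move=> lx; rewrite (innerJ (l2_delta n) lx) inner_deltal. Qed.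

Definition trunc N x : cseq := fun n => if (n < N)%N then x n else 0.

Lemma trunc_eq0 N x n : (N <= n)%N -> trunc N x n = 0.
Proof. by rewrite /trunc ltnNge => ->. Qed.

Lemma trunc_finitely_supported N x : finitely_supported (trunc N x).
Proof. by exists N => n; exact: trunc_eq0. Qed.

Lemma l2_trunc N x : l2 (trunc N x).
Proof. exact/l2_finitely_supported/trunc_finitely_supported. Qed.

Lemma sqnorm_trunc N x : sqnorm (trunc N x) = \sum_(0 <= n < N) sqmod (x n).
Proof.
have [_ ->] := @sqnormE R (trunc N x) N (trunc_eq0 x (N:=N)).
by rewrite !big_mkord; apply: eq_bigr => i _; rewrite /trunc ltn_ord.
Qed.

Lemma sqnorm_sub_trunc N x : l2 x ->
  sqnorm (x - trunc N x) = sqnorm x - \sum_(0 <= n < N) sqmod (x n).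
Proof.
move=> lx; have lt := l2_trunc N x; have ld := l2B lx lt.
have -> : sqnorm x = sqnorm (trunc N x + (x - trunc N x)).
  by rewrite [in RHS]addrC subrK.
rewrite (sqnormD lt ld).
suff -> : inner (trunc N x) (x - trunc N x) = 0 by rewrite sqnorm_trunc/=; ring.
rewrite (inner_finite _ (trunc_eq0 x (N:=N))) big_nat_cond big1//.
by move=> i /andP[/andP[_ iN] _]; rewrite /trunc !fctE iN subrr mulr0.
Qed.

Lemma trunc_cvg x : l2 x -> l2cvg (fun N => trunc N x) x.
Proof.
move=> lx; apply/l2cvgP => //; first by move=> k; exact: l2_trunc.
have -> : (fun k => norm2 (trunc k x - x)) =
    (fun k => Num.sqrt (sqnorm x - \sum_(0 <= n < k) sqmod (x n))).
  apply/funext => k; rewrite /norm2 -sqnormN; last by apply: l2B => //; exact: l2_trunc.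
  by rewrite opprB sqnorm_sub_trunc.
suff h : (fun k => sqnorm x - \sum_(0 <= n < k) sqmod (x n)) k @[k --> \oo] --> (0 : R).
  rewrite -[X in _ --> X](sqrtr0 R); apply: continuous_cvg h; exact: sqrt_continuous.
rewrite -[X in _ --> X](subrr (sqnorm x)); apply: cvgB; first exact: cvg_cst.
exact: sqnorm_cvg.
Qed.

Lemma l2cvg_small (u : nat -> cseq) x e : (forall k, l2 (u k)) -> l2 x ->
  l2cvg u x -> 0 < e -> \forall k \near \oo, norm2 (u k - x) < e.
Proof.
move=> lu lx /(l2cvgP lu lx)/cvgrPdist_lt h e0.
have := h e e0; apply: filterS => k.
by rewrite sub0r normrN ger0_norm// norm2_ge0.
Qed.

(** Closedness of an adjoint relation: the defect at the limit equals
    [inner q (u k - x) - inner p (v k - y)], which Cauchy-Schwarz makes small. *)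
Lemma inner_lim_eq (u v : nat -> cseq) p q x y :
  l2 p -> l2 q -> l2 x -> l2 y -> (forall k, l2 (u k)) -> (forall k, l2 (v k)) ->
  l2cvg u x -> l2cvg v y -> (forall k, inner p (v k) = inner q (u k)) ->
  inner p y = inner q x.
Proof.
move=> lp lq lx ly lu lv ux vy E; apply/eqP; rewrite -subr_eq0; apply/eqP/sqmod_eq0.
apply/eqP; rewrite eq_le sqmod_ge0 andbT; apply/ler_addgt0Pl => e e0; rewrite addr0.
(* The factors 2 come from [sqmodD_le]; the 1 keeps [M] positive when [p] and [q] vanish. *)
pose M := 2 * sqnorm p + 2 * sqnorm q + 1.
have M0 : 0 < M by rewrite ltr_pwDr// addr_ge0// mulr_ge0// sqnorm_ge0.
pose d := Num.sqrt (e / M).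
have d0 : 0 < d by rewrite sqrtr_gt0 divr_gt0.
have := filterI (l2cvg_small lu lx ux d0) (l2cvg_small lv ly vy d0).
move=> [K _ /(_ K (leqnn K))[uK vK]].
have -> : inner p y - inner q x = inner q (u K - x) - inner p (v K - y).
  by rewrite !innerBr// E; ring.
have lu1 := l2B (lu K) lx; have lv1 := l2B (lv K) ly.
have {}uK : sqnorm (u K - x) <= e / M.
  have := ltW uK; rewrite norm2_le ?(ltW d0)// /d sqr_sqrtr//.
  by rewrite divr_ge0 ?ltW.
have {}vK : sqnorm (v K - y) <= e / M.
  have := ltW vK; rewrite norm2_le ?(ltW d0)// /d sqr_sqrtr//.
  by rewrite divr_ge0 ?ltW.
apply: le_trans (sqmodD_le _ _) _; rewrite sqmodN.
have h1 := le_trans (sqmod_inner_le lq lu1) (ler_wpM2l (sqnorm_ge0 lq) uK).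
have h2 := le_trans (sqmod_inner_le lp lv1) (ler_wpM2l (sqnorm_ge0 lp) vK).
have -> : e = M * (e / M) by rewrite mulrC divfK// gt_eqF.
have eM : 0 <= e / M by rewrite divr_ge0 ?ltW.
apply: (@le_trans _ _ (2 * (sqnorm q * (e / M)) + 2 * (sqnorm p * (e / M)))).
  by rewrite lerD// ler_pM2l.
rewrite /M; set a := sqnorm p; set b := sqnorm q; set t := e / M in eM *.
rewrite -subr_ge0; have -> : (2 * a + 2 * b + 1) * t - (2 * (b * t) + 2 * (a * t)) = t by ring.
by [].
Qed.

End Truncation.

(** * The Jacobi matrix on finitely supported sequences *)

Section JacobiMatrix.
Variables (R : realType) (a b : nat -> R).
Local Notation cseq := (nat -> R[i]).
Local Notation rc := (real_complex R).
Local Notation J := (jacobi_action a b).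
Local Notation Q := (jacobi_poly0 a b).
Implicit Types (x y z h w : cseq) (c : R[i]).

Lemma jacobi_actionE x m :
  J x m = rc (a m) * x m.+1 + rc (b m) * x m +
          (if m is k.+1 then rc (a k) * x k else 0).
Proof.
rewrite /jacobi_action big_nat_recr//= big_nat_recr//= /jacobi_matrix !eqxx.
rewrite gtn_eqF// [X in X + _ + _ = _](_ : _ = if m is k.+1 then rc (a k) * x k else 0).
  by set u := if m is k.+1 then _ else _; ring.
case: m => [|k]; first by rewrite big_geq.
rewrite big_nat_recr//= eqxx !ltn_eqF// big_nat_cond big1 ?add0r//.
move=> i /andP[/andP[_ ik] _].
have -> : (i == k.+1) = false by rewrite ltn_eqF// ltnW.
have -> : (i == k.+2) = false by rewrite ltn_eqF// (leq_trans ik)// -addn2 leq_addr.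
by rewrite eqSS gtn_eqF// mul0r.
Qed.

Lemma jacobi_actionD x y : J (x + y) = J x + J y.
Proof.
apply/funext => m; rewrite cseqD !jacobi_actionE.
by case: m => [|m]; rewrite !cseqD; ring.
Qed.

Lemma jacobi_actionZ c x : J (scale_seq c x) = scale_seq c (J x).
Proof.
apply/funext => m; rewrite /scale_seq !jacobi_actionE.
case: m => [|m] /=; ring.
Qed.

Lemma jacobi_actionN x : J (- x) = - J x.
Proof. by rewrite -!scale_seqN1 jacobi_actionZ. Qed.

Lemma jacobi_actionB x y : J (x - y) = J x - J y.
Proof. by rewrite jacobi_actionD jacobi_actionN. Qed.

Lemma jacobi_action_eq0 x N : (forall n, (N <= n)%N -> x n = 0) ->
  forall n, (N.+1 <= n)%N -> J x n = 0.
Proof.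
move=> x0 [//|n] Nn; rewrite jacobi_actionE !x0 ?mulr0 ?addr0//.
- exact: ltnW.
- by rewrite (leq_trans _ (leqW Nn))// leqnSn.
Qed.

Lemma jacobi_action_finitely_supported x :
  finitely_supported x -> finitely_supported (J x).
Proof. by move=> [N /jacobi_action_eq0 h]; exists N.+1. Qed.

(** Green's formula: the real diagonal entries cancel and the off-diagonal terms telescope, leaving
    the Wronskian at the right end. *)
Lemma jacobi_green x y N :
  \sum_(0 <= n < N.+1) (conjc (J x n) * y n - conjc (x n) * J y n) =
  rc (a N) * (conjc (x N.+1) * y N - conjc (x N) * y N.+1).
Proof.
elim: N => [|N IH].
  rewrite big_nat1 !jacobi_actionE !addr0 conjcD !conjcM !conjc_real; ring.
rewrite big_nat_recr//= IH !jacobi_actionE !conjcD !conjcM !conjc_real; ring.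
Qed.

(** The boundary term of Green's formula vanishes beyond the support of [x], whatever [y] is; both
    inner products are finite sums. The cut is at [N.+1] because [J x] reaches one row further than
    [x]. *)
Lemma jacobi_action_sym x y : finitely_supported x ->
  inner (J x) y = inner x (J y).
Proof.
move=> [N x0]; rewrite (inner_finite _ (N := N.+1)); last exact: jacobi_action_eq0.
rewrite (inner_finite _ (N := N.+1)); last by move=> n /ltnW; exact: x0.
apply/eqP; rewrite -subr_eq0 -sumrB jacobi_green !x0//.
by rewrite conjc0 !mul0r subr0 mulr0.
Qed.

Hypothesis a_gt0 : forall n, 0 < a n.

Let a_neq0 n : a n != 0. Proof. by rewrite gt_eqF. Qed.

Lemma jacobi_poly0_0 : Q 0 = 1.
Proof. by rewrite /jacobi_poly0 /= hornerC. Qed.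

(** The recurrence at [z = 0]: [Q] is a formal null vector of the matrix, row 0 included. *)
Lemma jacobi_poly0_rec n :
  a n * Q n.+1 + b n * Q n + (if n is k.+1 then a k * Q k else 0) = 0.
Proof.
rewrite /jacobi_poly0; case: n => [|n].
  rewrite [jacobi_poly a b 1]/(_ *: _) [jacobi_poly a b 0]/1.
  rewrite !(hornerZ, hornerD, hornerN, hornerX, hornerC).
  by field; exact: a_neq0.
have -> : jacobi_poly a b n.+2 = (a n.+1)^-1 *:
    (('X - (b n.+1)%:P) * jacobi_poly a b n.+1 - a n *: jacobi_poly a b n) by [].
rewrite !(hornerZ, hornerD, hornerN, hornerM, hornerX, hornerC).
by field; exact: a_neq0.
Qed.

(** Reduction of order: since [Q] is a formal null vector, the diagonal entry can be eliminated, and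
    only the differences of [h] remain. *)
Lemma jacobi_action_by_parts h m :
  J (fun n => rc (Q n) * h n) m =
  (if m is k.+1 then rc (a k * Q k) * (h k - h k.+1) else 0)
  - rc (a m * Q m.+1) * (h m - h m.+1).
Proof.
rewrite jacobi_actionE.
have E : rc (b m) * rc (Q m) = - rc (a m * Q m.+1) -
    (if m is k.+1 then rc (a k * Q k) else 0).
  rewrite -rmorphM; have -> : b m * Q m = - (a m * Q m.+1) -
      (if m is k.+1 then a k * Q k else 0).
    by have := jacobi_poly0_rec m; set u := (if m is k.+1 then _ else _); lra.
  by rewrite rmorphB rmorphN/=; case: (m).
by rewrite [rc (b m) * _]mulrA E; case: m {E} => [|m]; rewrite !rmorphM/=; ring.
Qed.

(* The coefficients for which the column [Q] truncated after index [j], times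
   [green_weight j], is mapped by [J] to [delta j / Q j - delta j.+1 / Q j.+1]. *)
Definition green_weight j : R := - (a j * Q j * Q j.+1)^-1.

Local Notation gw := green_weight.


Section AlternatingSigns.
Hypothesis Q_alt : forall n, Q n * Q n.+1 < 0.

Lemma jacobi_poly0_neq0 n : Q n != 0.
Proof. by apply: contraTneq (Q_alt n) => ->; rewrite mul0r ltxx. Qed.

Lemma green_weight_gt0 n : 0 < gw n.
Proof. by rewrite /gw oppr_gt0 invr_lt0 -mulrA pmulr_rlt0. Qed.

(** Variation of constants. The weights turn the two coefficients of [jacobi_action_by_parts] into
    [- 1 / Q m], so row [m] is [1 / Q m] times the difference of two consecutive partial sums of
    [Q n * w n], that is [w m]. *)
Lemma jacobi_action_solution h w :
  (forall m, h m - h m.+1 = rc (gw m) * \sum_(0 <= n < m.+1) rc (Q n) * w n) ->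
  J (fun n => rc (Q n) * h n) = w.
Proof.
move=> hE; apply/funext => m; rewrite jacobi_action_by_parts.
have Ek k s : rc (a k * Q k) * (rc (gw k) * s) = - rc ((Q k.+1)^-1) * s.
  rewrite mulrA -rmorphM; congr (_ * _); rewrite -rmorphN /gw; congr rc.
  by field; rewrite !jacobi_poly0_neq0 a_neq0.
have Em k s : rc (a k * Q k.+1) * (rc (gw k) * s) = - rc ((Q k)^-1) * s.
  rewrite mulrA -rmorphM; congr (_ * _); rewrite -rmorphN /gw; congr rc.
  by field; rewrite !jacobi_poly0_neq0 a_neq0.
have QK k s : rc ((Q k)^-1) * (rc (Q k) * s) = s.
  by rewrite mulrA -rmorphM mulVf ?jacobi_poly0_neq0// rmorph1 mul1r.
rewrite hE Em; case: m => [|m]; first by rewrite big_nat1 mulNr QK; ring.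
rewrite hE Ek [in X in _ - X]big_nat_recr//= mulrDr !mulNr QK; ring.
Qed.

(** Summing the increments of [h] from the right makes [h] vanish from [N] on. *)
Lemma jacobi_range_finite w N : (forall n, (N <= n)%N -> w n = 0) ->
  \sum_(0 <= n < N) rc (Q n) * w n = 0 ->
  exists2 u, finitely_supported u & J u = w.
Proof.
move=> w0 sw0; pose s m := \sum_(0 <= n < m.+1) rc (Q n) * w n.
pose h m := \sum_(m <= j < N) rc (gw j) * s j.
exists (fun n => rc (Q n) * h n).
  by exists N => n Nn; rewrite /h big_geq// mulr0.
apply: jacobi_action_solution => m; rewrite -/(s m) /h.
have [mN|Nm] := ltnP m N; first by rewrite (big_ltn mN) addrK.
(* Beyond [N] the increments of [h] are 0, so the partial sum [s m] must vanish as well; this is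
   where the moment condition enters. *)
rewrite (big_geq Nm) (big_geq (leqW Nm)) subrr.
suff -> : s m = 0 by rewrite mulr0.
have -> : s m = \sum_(0 <= n < N) rc (Q n) * w n + \sum_(N <= n < m.+1) rc (Q n) * w n.
  exact: big_cat_nat (leqW Nm).
rewrite sw0 add0r big_nat_cond big1//.
by move=> i /andP[/andP[/w0 -> _] _]; rewrite mulr0.
Qed.

End AlternatingSigns.

End JacobiMatrix.

(** * Consequences of positivity: alternating signs, monotonicity in the diagonal, dense range *)

Section Positivity.
Variable R : realType.
Local Notation cseq := (nat -> R[i]).
Local Notation Re := (@complex.Re R).
Local Notation rc := (real_complex R).
Implicit Types (a b : nat -> R) (x y z h w : cseq) (c : R[i]).

Lemma finitely_supportedD x y :
  finitely_supported x -> finitely_supported y -> finitely_supported (x + y).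
Proof.
move=> [M xM] [N yN]; exists (maxn M N) => n; rewrite geq_max => /andP[Mn Nn].
by rewrite cseqD xM// yN// addr0.
Qed.

Lemma finitely_supportedZ c x :
  finitely_supported x -> finitely_supported (scale_seq c x).
Proof. by move=> [M xM]; exists M => n /xM; rewrite /scale_seq => ->; rewrite mulr0. Qed.

(** Positivity on finitely supported vectors only; in this form it passes to the diagonal [b + 1]
    without any discussion of the closure. *)
Definition jacobi_nonneg a b :=
  forall x, finitely_supported x -> 0 <= Re (inner x (jacobi_action a b x)).

(** Let [v] be [Q] truncated after [n]. The form on [v + t * delta n.+1] is a nonnegative quadratic
    in [t], whose discriminant condition reads [(a n * Q n) ^+ 2 <= b n.+1 * - (a n * Q n * Q
    n.+1)]. The left side is positive once [Q n] is nonzero, so the last factor is positive too;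
    this also excludes [Q n.+1 = 0], and the induction continues. *)
Lemma jacobi_poly0_alt a b : (forall n, 0 < a n) -> jacobi_nonneg a b ->
  forall n, jacobi_poly0 a b n * jacobi_poly0 a b n.+1 < 0.
Proof.
move=> a0 psd; set Q := jacobi_poly0 a b; set J := jacobi_action a b.
suff H n : Q n != 0 -> Q n * Q n.+1 < 0.
  elim => [|n IH]; apply: H; first by rewrite /Q jacobi_poly0_0 oner_neq0.
  by apply: contraTneq IH => ->; rewrite mulr0 ltxx.
move=> Qn.
pose h : cseq := fun m => (m <= n)%N%:R.
pose v := (fun m => rc (Q m) * h m).
have v0 m : (n.+1 <= m)%N -> v m = 0.
  by rewrite /v /h ltnNge => /negbTE ->; rewrite mulr0.
have fv : finitely_supported v by exists n.+1.
pose d : cseq := delta R n.+1.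
have fd : finitely_supported d := delta_finitely_supported R n.+1.
have [lv ld] := (l2_finitely_supported fv, l2_finitely_supported fd).
have lJv := l2_finitely_supported (jacobi_action_finitely_supported a b fv).
have lJd := l2_finitely_supported (jacobi_action_finitely_supported a b fd).
have Jv m : (m <= n)%N -> J v m = - rc (a m * Q m.+1) * (1 - h m.+1).
  move=> mn; rewrite /J /v jacobi_action_by_parts// /h mn.
  case: m mn => [|m] mn; first by rewrite sub0r mulNr.
  by rewrite mn (ltnW mn) subrr mulr0 sub0r mulNr.
have Jvn : J v n.+1 = rc (a n * Q n).
  rewrite /J /v jacobi_action_by_parts// /h leqnn ltnn.
  by rewrite (_ : (n.+2 <= n)%N = false) ?subr0 ?subrr ?mulr0 ?subr0 ?mulr1// leqNgt leqnSn.
have E1 : inner v (J v) = - rc (a n * Q n * Q n.+1).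
  rewrite (inner_finite _ v0) big_nat_recr//= big_nat_cond big1 ?add0r.
    rewrite Jv// /v /h leqnn ltnn mulr1 subr0 mulr1 conjc_real -!rmorphN -rmorphM.
    by congr rc; ring.
  move=> i /andP[/andP[_ ilt] _]; rewrite Jv ?(ltnW ilt)// /h ilt subrr.
  by rewrite !mulr0.
have E2 : inner d (J v) = rc (a n * Q n) by rewrite inner_deltal.
have E3 : inner v (J d) = rc (a n * Q n).
  by rewrite -jacobi_action_sym// inner_deltar// -/J Jvn conjc_real.
have E4 : inner d (J d) = rc (b n.+1).
  rewrite inner_deltal /J jacobi_actionE /d /delta eqxx gtn_eqF// ltn_eqF//.
  by rewrite !mulr0 add0r addr0 mulr1.
have bn : 0 <= b n.+1 by have := psd d fd; rewrite -/J E4.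
have := @quadratic_ge0_discr R (b n.+1) (a n * Q n) (- (a n * Q n * Q n.+1)) bn.
have quad t : 0 <= b n.+1 * t ^+ 2 + 2 * (a n * Q n) * t + - (a n * Q n * Q n.+1).
  have ftd := finitely_supportedZ (rc t) fd.
  have ltd := l2_finitely_supported ftd.
  have ltJd : l2 (scale_seq (rc t) (J d)) by exact: l2_scale_seq.
  have := psd _ (finitely_supportedD fv ftd).
  rewrite jacobi_actionD jacobi_actionZ -/J innerDl//; last exact: l2D.
  rewrite !innerDr// innerZl// innerZr// innerZl// innerZr// E1 E2 E3 E4 conjc_real.
  rewrite -rmorphN -!(rmorphM, rmorphD) /=; congr (_ <= _); ring.
move=> /(_ quad) D; have an := a0 n.
have P0 : 0 < (a n * Q n) ^+ 2 by rewrite exprn_even_gt0//= mulf_neq0// gt_eqF.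
have {P0}D := lt_le_trans P0 D.
have : 0 < - (a n * Q n * Q n.+1).
  rewrite ltNge; apply/negP => le0; move: D; rewrite ltNge => /negP; apply.
  exact: mulr_ge0_le0.
by rewrite oppr_gt0 -mulrA pmulr_rlt0.
Qed.

(** With signs removed, [p n = (-1) ^+ n * Q n] is positive. The Wronskian [W] of the two solutions
    grows at each step by [(b' n - b n)] times a positive product, so the ratio of the solutions is
    nondecreasing, and it starts at 1. *)
Lemma jacobi_poly0_monotone a b b' : (forall n, 0 < a n) ->
  (forall n, b n <= b' n) ->
  (forall n, jacobi_poly0 a b n * jacobi_poly0 a b n.+1 < 0) ->
  (forall n, jacobi_poly0 a b' n * jacobi_poly0 a b' n.+1 < 0) ->
  forall n, jacobi_poly0 a b n ^+ 2 <= jacobi_poly0 a b' n ^+ 2.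
Proof.
move=> a0 bb' Qalt Q'alt.
pose p (b0 : nat -> R) n := (-1) ^+ n * jacobi_poly0 a b0 n.
have p0 b0 : (forall n, jacobi_poly0 a b0 n * jacobi_poly0 a b0 n.+1 < 0) ->
    forall n, 0 < p b0 n.
  move=> alt; elim => [|n IH]; first by rewrite /p jacobi_poly0_0 expr0 mul1r.
  rewrite -(pmulr_rgt0 _ IH) (_ : _ * _ = - (jacobi_poly0 a b0 n * jacobi_poly0 a b0 n.+1)).
    by rewrite oppr_gt0.
  rewrite /p exprS; have := sqrr_sign R n; rewrite expr2; set t := (-1) ^+ n => t2.
  rewrite [LHS](_ : _ = - (t * t * (jacobi_poly0 a b0 n * jacobi_poly0 a b0 n.+1))).
    by rewrite t2 mul1r.
  ring.
have rec b0 n : a n * p b0 n.+1 = b0 n * p b0 n - (if n is k.+1 then a k * p b0 k else 0).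
  have := jacobi_poly0_rec b0 a0 n; rewrite /p exprS.
  case: n => [|n]; rewrite ?expr0 ?exprS; set u := jacobi_poly0 _ _ _.
    by rewrite addr0 => h; lra.
  move=> h; transitivity ((-1) ^+ n * (a n.+1 * u)); first ring.
  set t := (-1) ^+ n.
  have -> : a n.+1 * u = - b0 n.+1 * jacobi_poly0 a b0 n.+1 - a n * jacobi_poly0 a b0 n by lra.
  ring.
have pb := p0 _ Qalt; have pb' := p0 _ Q'alt.
have W n : 0 <= a n * (p b' n.+1 * p b n - p b' n * p b n.+1).
  elim: n => [|n IH].
    rewrite mulrBr mulrA rec [a 0 * (_ * _)]mulrCA rec !subr0.
    rewrite [X in _ <= X](_ : _ = (b' 0 - b 0) * (p b' 0 * p b 0)); last ring.
    by rewrite mulr_ge0 ?subr_ge0// mulr_ge0// ltW.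
  rewrite mulrBr mulrA rec [a n.+1 * (_ * _)]mulrCA rec.
  rewrite [X in _ <= X](_ : _ = (b' n.+1 - b n.+1) * (p b' n.+1 * p b n.+1) +
     a n * (p b' n.+1 * p b n - p b' n * p b n.+1)); last ring.
  by rewrite addr_ge0// mulr_ge0 ?subr_ge0// mulr_ge0// ltW.
have pp n : p b n <= p b' n.
  elim: n => [|n IH]; first by rewrite /p !jacobi_poly0_0.
  have := W n; rewrite pmulr_rge0// subr_ge0 => h.
  rewrite -(ler_pM2r (pb n)); apply: le_trans h.
  by rewrite mulrC ler_pM2r.
have sq b0 n : jacobi_poly0 a b0 n ^+ 2 = p b0 n ^+ 2 by rewrite /p exprMn sqrr_sign mul1r.
by move=> n; rewrite !sq ler_sqr ?nnegrE ?(ltW (pb n)) ?(ltW (pb' n)).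
Qed.

(** The only obstruction to a finite [y] lying in the range is its moment [s] against [Q].
    Subtracting [s / S N] times [Q] truncated at [N] removes it, at the cost of a correction of
    squared norm [sqmod s / S N], which is small because [S N] is unbounded. *)
Lemma jacobi_range_dense a b : (forall n, 0 < a n) ->
  (forall n, jacobi_poly0 a b n * jacobi_poly0 a b n.+1 < 0) ->
  (forall M, exists N, M <= \sum_(0 <= n < N) jacobi_poly0 a b n ^+ 2) ->
  forall y e, l2 y -> 0 < e ->
  exists2 u, finitely_supported u & norm2 (jacobi_action a b u - y) < e.
Proof.
move=> a0 alt; set Q := jacobi_poly0 a b => div y e ly e0.
have e20 : 0 < e / 2 by rewrite divr_gt0.
have lt k : l2 (trunc k y) := l2_trunc k y.
have [M _ /(_ M (leqnn M)) hM] := l2cvg_small lt ly (trunc_cvg ly) e20.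
pose s := \sum_(0 <= n < M) rc (Q n) * y n.
pose S N := \sum_(0 <= n < N) Q n ^+ 2.
(* The threshold makes the correction at most [e / 2]; the 1 makes [S N0] positive even when
   [s = 0]. *)
have [N0 hN0] := div (sqmod s / (e / 2) ^+ 2 + 1).
pose N := maxn M N0.
have S0 : 0 < S N0.
  by apply: lt_le_trans hN0; rewrite ltr_wpDl// divr_ge0 ?sqr_ge0 ?sqmod_ge0.
have SN : S N0 <= S N.
  rewrite /S (@big_cat_nat _ _ _ N0 _ N) ?leq_maxr//= lerDl.
  by apply: sumr_ge0 => *; exact: sqr_ge0.
have SN0 := lt_le_trans S0 SN.
pose q := trunc N (fun n => rc (Q n)).
pose w := trunc M y - scale_seq (s / rc (S N)) q.
have lq : l2 q := l2_trunc N _.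
have w0 n : (N <= n)%N -> w n = 0.
  move=> Nn; rewrite /w cseqD cseqN /scale_seq /q (trunc_eq0 _ Nn) mulr0 subr0.
  by rewrite trunc_eq0// (leq_trans _ Nn)// leq_maxl.
have sw : \sum_(0 <= n < N) rc (Q n) * w n = 0.
  have -> : \sum_(0 <= n < N) rc (Q n) * w n =
     \sum_(0 <= n < N) rc (Q n) * trunc M y n - s / rc (S N) * \sum_(0 <= n < N) rc (Q n ^+ 2).
    rewrite mulr_sumr -sumrB !big_mkord; apply: eq_bigr => i _.
    rewrite /w cseqD cseqN /scale_seq /q {2}/trunc ltn_ord mulrBr; congr (_ - _).
    by rewrite mulrCA -rmorphM.
  have -> : \sum_(0 <= n < N) rc (Q n) * trunc M y n = s.
    rewrite (@big_cat_nat _ _ _ M) ?leq_maxl//= [X in _ + X]big_nat_cond [X in _ + X]big1.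
      rewrite addr0 /s !big_mkord; apply: eq_bigr => i _.
      by rewrite /trunc ltn_ord.
    by move=> i /andP[/andP[Mi _] _]; rewrite trunc_eq0// mulr0.
  rewrite -rmorph_sum/= -/(S N) divfK ?subrr//.
  by rewrite (_ : 0 = rc 0)// (inj_eq (@complexI R)) gt_eqF.
have [u fu Ju] := jacobi_range_finite a0 alt w0 sw.
exists u => //; rewrite Ju.
have -> : w - y = (trunc M y - y) + - scale_seq (s / rc (S N)) q.
  by rewrite /w; ring.
have lc : l2 (scale_seq (s / rc (S N)) q) by exact: l2_scale_seq.
have lty := l2B (lt M) ly.
apply: le_lt_trans (norm2D lty (l2N lc)) _; rewrite norm2N//.
rewrite [ltRHS](splitr e) ltr_leD//.
rewrite norm2_le ?(ltW e20)// sqnormZ// sqnorm_trunc.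
have -> : \sum_(0 <= n < N) sqmod (rc (Q n)) = S N.
  by apply: eq_bigr => n _; rewrite sqmodR.
have -> : sqmod (s / rc (S N)) * S N = sqmod s / S N.
  rewrite -fmorphV sqmodM sqmodR; field; by rewrite gt_eqF.
rewrite ler_pdivrMr// mulrC -ler_pdivrMr ?exprn_gt0//.
by rewrite (le_trans _ SN)// (le_trans _ hN0)// lerDl.
Qed.

End Positivity.

(** * Self-adjointness *)

Section JacobiOperator.
Variables (R : realType) (a b : nat -> R).
Local Notation cseq := (nat -> R[i]).
Local Notation Re := (@complex.Re R).
Local Notation rc := (real_complex R).
Local Notation J := (jacobi_action a b).
Local Notation Q := (jacobi_poly0 a b).
Implicit Types (x y z p q : cseq) (c : R[i]).

Lemma l2cvg_cst x : l2 x -> l2cvg (fun=> x) x.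
Proof.
move=> lx; apply/l2cvgP => //; rewrite subrr.
have [z _] := sqnorm0 R.
by rewrite /norm2 -[X in Num.sqrt (sqnorm X)]/(fun=> 0) z sqrtr0; exact: cvg_cst.
Qed.

Lemma jacobi_operator_finite x :
  finitely_supported x -> jacobi_operator a b (x, J x).
Proof.
move=> fx; have lx := l2_finitely_supported fx.
have lJx := l2_finitely_supported (jacobi_action_finitely_supported a b fx).
split=> //; exists (fun=> x), (fun=> J x); split=> //; exact: l2cvg_cst.
Qed.

Lemma inner_jacobi_action p x : l2 p -> l2 (J p) -> finitely_supported x ->
  inner p (J x) = inner (J p) x.
Proof.
move=> lp lJp fx; have lx := l2_finitely_supported fx.
have lJx := l2_finitely_supported (jacobi_action_finitely_supported a b fx).
by rewrite (innerJ lJx lp) jacobi_action_sym// -innerJ.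
Qed.

Lemma jacobi_operator_adjoint p x y : l2 p -> l2 (J p) ->
  jacobi_operator a b (x, y) -> inner p y = inner (J p) x.
Proof.
move=> lp lJp [/= lx ly [u [v [uv ux vy]]]].
apply: (inner_lim_eq (u := u) (v := v)) => //= k.
- by have [/l2_finitely_supported] := uv k.
- have [fu /= ->] := uv k.
  by apply/l2_finitely_supported/jacobi_action_finitely_supported.
- by have [fu /= ->] := uv k; exact: inner_jacobi_action.
Qed.

(** Testing against [delta n] shows that taking the closure does not change the action, so the graph
    is single-valued. *)
Lemma jacobi_operatorW x y : jacobi_operator a b (x, y) ->
  [/\ l2 x, l2 y & y = J x].
Proof.
move=> Jxy; have [/= lx ly _] := Jxy; split=> //.
apply/funext => n; rewrite -(inner_deltal n y) -(inner_deltal n (J x)).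
have fd := delta_finitely_supported R n.
rewrite (jacobi_operator_adjoint _ _ Jxy).
- exact: jacobi_action_sym.
- exact: l2_delta.
- exact/l2_finitely_supported/jacobi_action_finitely_supported.
Qed.

(** The adjoint is the matrix on its maximal domain: pairing with [delta n] reads off entry [n].
    Self-adjointness is thereby reduced to [jacobi_operator_maximal]. *)
Lemma jacobi_adjointP p q :
  graph_adjoint (jacobi_operator a b) (p, q) <-> [/\ l2 p, l2 q & q = J p].
Proof.
split=> [[/= lp lq h]|[lp lq E]]; split=> //=.
- apply/funext => n; have fd := delta_finitely_supported R n.
  have fJd := jacobi_action_finitely_supported a b fd.
  have := h _ _ (jacobi_operator_finite fd).
  rewrite inner_deltar// (innerJ (l2_finitely_supported fJd) lp).
  rewrite jacobi_action_sym// inner_deltal.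
  by move=> /(congr1 conjc); rewrite !conjcK.
- by move=> x y; rewrite E; apply: jacobi_operator_adjoint => //; rewrite -E.
Qed.

Hypothesis a_gt0 : forall n, 0 < a n.

(** Row 0 determines [x 1] from [x 0] and each later row the next entry, since the [a n] are
    nonzero; the induction carries two consecutive entries. *)
Lemma jacobi_kernel x : J x = (fun=> 0) -> forall n, x n = x 0 * rc (Q n).
Proof.
move=> Jx; suff H n : x n = x 0 * rc (Q n) /\ x n.+1 = x 0 * rc (Q n.+1).
  by move=> n; case: (H n).
have an n0 : rc (a n0) != 0.
  by rewrite (_ : 0 = rc 0)// (inj_eq (@complexI R)) gt_eqF.
have st m : rc (a m) * x m.+1 = - (rc (b m) * x m) - (if m is k.+1 then rc (a k) * x k else 0).
  apply/eqP; rewrite -subr_eq0 opprD !opprK addrA -jacobi_actionE Jx; exact/eqP.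
have stQ m : rc (a m) * rc (Q m.+1) =
    - (rc (b m) * rc (Q m)) - (if m is k.+1 then rc (a k) * rc (Q k) else 0).
  rewrite -!rmorphM; have -> : a m * Q m.+1 = - (b m * Q m) - (if m is k.+1 then a k * Q k else 0).
    by have := jacobi_poly0_rec b a_gt0 m; set u := (if m is k.+1 then _ else _); lra.
  by rewrite rmorphB rmorphN; case: (m) => [|k]; rewrite ?rmorphM ?rmorph0.
elim: n => [|n [IH0 IH1]].
  split; first by rewrite jacobi_poly0_0 mulr1.
  apply: (mulfI (an 0)); rewrite st [RHS]mulrCA stQ jacobi_poly0_0 rmorph1 !subr0; ring.
split=> //; apply: (mulfI (an n.+1)).
rewrite st [RHS]mulrCA stQ IH0 IH1; ring.
Qed.

Hypothesis Q_div : forall M, exists N, M <= \sum_(0 <= n < N) Q n ^+ 2.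

Lemma jacobi_kernel_l2 x : l2 x -> J x = (fun=> 0) -> x = (fun=> 0).
Proof.
move=> lx /jacobi_kernel xE; suff x0 : x 0 = 0.
  by apply/funext => n; rewrite xE x0 mul0r.
apply/sqmod_eq0/eqP; apply: contraT => nz.
have pz : 0 < sqmod (x 0) by rewrite lt_neqAle eq_sym nz sqmod_ge0.
(* At this [N] the partial sum of [sqmod (x n)] would exceed [sqnorm x] by at least 1. *)
have [N hN] := Q_div ((sqnorm x + 1) / sqmod (x 0)).
have := sqnorm_ge N lx; under eq_bigr do rewrite xE sqmodM sqmodR.
rewrite -mulr_sumr => h.
have := le_trans (ler_wpM2l (ltW pz) hN) h.
by rewrite mulrC divfK// gerDl ler10.
Qed.

Lemma jacobi_operator_invertible : invertible (jacobi_operator a b).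
Proof.
move=> [x x0 /jacobi_operatorW[lx _ E]]; apply: x0.
apply: jacobi_kernel_l2 => //; rewrite -E.
by apply/funext => n; rewrite mul0r.
Qed.

Hypothesis J_nonneg : jacobi_nonneg a b.

(** The diagonal of [J + 1], which is bounded below by 1 on finite vectors, so that convergence of
    images controls convergence of preimages. *)
Let b1 n := b n + 1.
Local Notation J1 := (jacobi_action a b1).

Let J1E x : J1 x = J x + x.
Proof.
apply/funext => m; rewrite cseqD !jacobi_actionE /b1 rmorphD rmorph1.
set u := (if m is k.+1 then _ else _); ring.
Qed.

Let J1_fs x : finitely_supported x -> finitely_supported (J1 x).
Proof. exact: jacobi_action_finitely_supported. Qed.

Let J1_ge x : finitely_supported x -> sqnorm x <= Re (inner x (J1 x)).
Proof.
move=> fx; have lx := l2_finitely_supported fx.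
have lJx := l2_finitely_supported (jacobi_action_finitely_supported a b fx).
rewrite J1E innerDr// cReD -sqnorm_inner// lerDr; exact: J_nonneg.
Qed.

Let J1_bounded_below x : finitely_supported x -> norm2 x <= norm2 (J1 x).
Proof.
move=> fx; have lx := l2_finitely_supported fx.
have lJx := l2_finitely_supported (J1_fs fx).
have := le_trans (J1_ge fx) (le_trans (ler_norm _) (norm_Re_inner lx lJx)).
rewrite -norm2_sq// expr2; have := norm2_ge0 x; rewrite le_eqVlt => /orP[/eqP<- _|x0].
  exact: norm2_ge0.
by rewrite ler_pM2l.
Qed.

Let J1_dense y e : l2 y -> 0 < e ->
  exists2 u, finitely_supported u & norm2 (J1 u - y) < e.
Proof.
have n1 : jacobi_nonneg a b1.
  by move=> x fx; apply: le_trans (J1_ge fx); exact/sqnorm_ge0/l2_finitely_supported.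
apply: jacobi_range_dense => //; first exact: jacobi_poly0_alt.
move=> M; have [N hN] := Q_div M; exists N; apply: le_trans hN _.
apply: ler_sum => n _; apply: jacobi_poly0_monotone => //.
- by move=> m; rewrite /b1 lerDl ler01.
- exact: jacobi_poly0_alt.
- exact: jacobi_poly0_alt.
Qed.

(** Positivity is not yet known on the maximal domain, so duality replaces it: approximate [p] by
    [J1 u] with [u] finite. Then [inner p p] is close to [inner p (J1 u) = inner (J p + p) u], and
    [norm2 u <= norm2 (J1 u)] is close to [norm2 p]. *)
Lemma norm2_le_jacobi_shift p : l2 p -> l2 (J p) -> norm2 p <= norm2 (J p + p).
Proof.
move=> lp lJp; have lJ1p := l2D lJp lp.
set P := norm2 p; set N := norm2 _.
have P0 : 0 <= P := norm2_ge0 p; have N0 : 0 <= N := norm2_ge0 _.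
have H e : 0 < e -> P ^+ 2 <= N * (P + e) + P * e.
  move=> e0; have [u fu ue] := J1_dense lp e0.
  have lu := l2_finitely_supported fu; have lJu := l2_finitely_supported (J1_fs fu).
  have lJup := l2B lJu lp.
  have lJu0 := l2_finitely_supported (jacobi_action_finitely_supported a b fu).
  have E : inner p (J1 u) = inner (J p + p) u.
    by rewrite J1E innerDr// innerDl// inner_jacobi_action.
  have -> : P ^+ 2 = Re (inner (J p + p) u) - Re (inner p (J1 u - p)).
    by rewrite innerBr// !cReImE -E /P norm2_sq// -sqnorm_inner//; ring.
  have h1 := le_trans (ler_norm _) (norm_Re_inner lJ1p lu).
  have h2 := norm_Re_inner lp lJup; rewrite ler_norml in h2.
  have /andP[{}h2 _] := h2.
  have h3 : norm2 u <= P + e.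
    apply: le_trans (J1_bounded_below fu) _.
    have -> : J1 u = p + (J1 u - p) by rewrite addrC subrK.
    by apply: le_trans (norm2D lp lJup) _; rewrite lerD2l ltW.
  have h4 := ler_wpM2l N0 h3.
  have h5 := ler_wpM2l P0 (ltW ue).
  rewrite lerD//; first exact: le_trans h4.
  by rewrite lerNl; apply: le_trans h2; rewrite lerN2.
rewrite leNgt; apply/negP => NP; have Pp := le_lt_trans N0 NP.
have NPp : 0 < N + P by rewrite ltr_wpDl.
(* Chosen so that the error [(N + P) * e] is half of the gap [P ^+ 2 - N * P]. *)
have := H (P * (P - N) / (2 * (N + P))).
rewrite divr_gt0 ?mulr_gt0 ?subr_gt0// => /(_ isT).
set e := _ / _ => He.
have : (N + P) * e = P * (P - N) / 2 by rewrite /e; field; rewrite gt_eqF.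
have : 0 < P * (P - N) by rewrite mulr_gt0// subr_gt0.
move: He; rewrite expr2; lra.
Qed.

(** Take finite [u k] with [J1 (u k)] tending to [J p + p]. The preceding bound, applied to
    [p - u k], makes [u k] tend to [p]; subtraction then gives [J (u k)] tending to [J p]. *)
Lemma jacobi_operator_maximal p : l2 p -> l2 (J p) -> jacobi_operator a b (p, J p).
Proof.
move=> lp lJp; have lJ1p := l2D lJp lp.
have ex k : exists u, finitely_supported u /\ norm2 (J1 u - (J p + p)) < k.+1%:R^-1.
  by have [|u fu ue] := @J1_dense (J p + p) k.+1%:R^-1 lJ1p; [rewrite invr_gt0|exists u].
have [u Hu] := choice ex.
have fu k : finitely_supported (u k) by case: (Hu k).
have lu k := l2_finitely_supported (fu k).
have lJu k := l2_finitely_supported (jacobi_action_finitely_supported a b (fu k)).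
have ue k : norm2 (J (u k) + u k - (J p + p)) < k.+1%:R^-1.
  by rewrite -J1E; case: (Hu k).
have D k : J (p - u k) + (p - u k) = - (J (u k) + u k - (J p + p)).
  by rewrite jacobi_actionB; ring.
have le1 k : norm2 (u k - p) <= k.+1%:R^-1.
  rewrite -norm2N; last exact: l2B.
  rewrite opprB; apply: le_trans (norm2_le_jacobi_shift _ _) _.
  - exact: l2B.
  - by rewrite jacobi_actionB; exact: l2B.
  - rewrite D norm2N; first exact: ltW.
    by apply: l2B => //; exact: l2D.
have le2 k : norm2 (J (u k) - J p) <= 2 * k.+1%:R^-1.
  have -> : J (u k) - J p = (J (u k) + u k - (J p + p)) + - (u k - p) by ring.
  have l1 : l2 (J (u k) + u k - (J p + p)) by apply: l2B => //; exact: l2D.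
  have l3 := l2B (lu k) lp.
  apply: le_trans (norm2D l1 (l2N l3)) _; rewrite norm2N//.
  by rewrite mulr_natl mulr2n lerD// ltW.
split=> //=; exists u, (fun k => J (u k)); split=> //=.
- apply/l2cvgP => //; apply: (@squeeze_cvgr _ _ _ _ (fun=> 0) (fun k => k.+1%:R^-1)).
  + by apply: nearW => k; rewrite norm2_ge0 le1.
  + exact: cvg_cst.
  + exact: cvg_harmonic.
- apply/l2cvgP => //; apply: (@squeeze_cvgr _ _ _ _ (fun=> 0) (fun k => 2 * k.+1%:R^-1)).
  + by apply: nearW => k; rewrite norm2_ge0 le2.
  + exact: cvg_cst.
  + by rewrite -[X in _ --> X](mulr0 2); apply: cvgMr; exact: cvg_harmonic.
Qed.

Lemma jacobi_operator_self_adjoint : self_adjoint (jacobi_operator a b).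
Proof.
split.
  move=> x lx; exists (fun k => trunc k x); split; last exact: trunc_cvg.
  move=> k; exists (J (trunc k x)).
  exact/jacobi_operator_finite/trunc_finitely_supported.
apply/seteqP; split=> -[p q].
- by move=> /jacobi_adjointP[lp lq E]; rewrite E in lq *; exact: jacobi_operator_maximal.
- by move=> /jacobi_operatorW h; exact/jacobi_adjointP.
Qed.

End JacobiOperator.

(** * The inverse as a sum of rank-one operators *)

Section Series.
Variable R : realType.
Implicit Types (f g d : nat -> R).

Lemma cvg_nneseries f s :
  (\sum_(0 <= n < N) f n) @[N --> \oo] --> s ->
  (\sum_(0 <= n <oo) (f n)%:E)%E = s%:E.
Proof.
move=> fs; rewrite -(cvg_lim _ fs)// -EFin_lim; last by apply/cvg_ex; exists s.
by congr (limn _); apply/funext => N /=; rewrite sumEFin.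
Qed.

Lemma nneseries_cvg f : (forall n, 0 <= f n) ->
  (\sum_(0 <= n <oo) (f n)%:E < +oo)%E ->
  (\sum_(0 <= n < N) f n) @[N --> \oo] --> fine (\sum_(0 <= n <oo) (f n)%:E)%E.
Proof.
move=> f0 foo; have /cvg_ex[s fs] := nnseries_is_cvg f0 foo.
by rewrite (cvg_nneseries fs).
Qed.

Lemma nneseries_oppe (u : nat -> \bar R) m : (forall n, 0 <= u n)%E ->
  (\sum_(m <= n <oo) - u n = - \sum_(m <= n <oo) u n)%E.
Proof.
move=> u0; rewrite -limeN; last by apply: is_cvg_nneseries => *; exact: u0.
congr (limn _); apply/funext => N; apply: sumeN => i j _ _.
by apply: ge0_adde_def; rewrite inE.
Qed.

(** Tonelli on the region [n <= j], extended by zero to the full quadrant. *)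
Lemma nneseries_tail_weight g d : (forall n, 0 <= g n) -> (forall n, 0 <= d n) ->
  (\sum_(0 <= n <oo) ((\sum_(n <= j <oo) (g j)%:E) * (d n)%:E) =
   \sum_(0 <= j <oo) (g j * \sum_(0 <= n < j.+1) d n)%:E)%E.
Proof.
move=> g0 d0; pose F n j : \bar R := (if (n <= j)%N then g j * d n else 0)%:E.
have F0 n j : (0 <= F n j)%E by rewrite lee_fin; case: ifP => // _; rewrite mulr_ge0.
transitivity (\sum_(0 <= n <oo) \sum_(0 <= j <oo) F n j)%E.
  apply: eq_eseriesr => n _; rewrite muleC -nneseriesZl//; last first.
    by move=> j _; rewrite lee_fin.
  rewrite ereal_series eseries_mkcond; apply: eq_eseriesr => j _.
  by rewrite /F; case: ifP => // _; rewrite -EFinM mulrC.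
rewrite nneseries_interchange//; apply: eq_eseriesr => j _.
apply: cvg_nneseries; apply: cvg_near_cst; exists j.+1 => // N /= jN.
rewrite (@big_cat_nat _ _ _ j.+1)//= [X in _ + X]big_nat_cond [X in _ + X]big1 ?addr0; last first.
  by move=> i /andP[/andP[ji _] _]; rewrite leqNgt ji.
rewrite mulr_sumr !big_mkord; apply: eq_bigr => i _.
by rewrite -ltnS ltn_ord.
Qed.

End Series.

(** * Tails of the weights and their summation by parts *)

Section TailSums.
Variables (R : realType) (g d : nat -> R).
Hypotheses (g_ge0 : forall n, 0 <= g n) (d_ge0 : forall n, 0 <= d n).
Hypothesis d0 : d 0 = 1.
Let D n := \sum_(0 <= i < n) d i.
Variable t : R.
Hypothesis gDt : (\sum_(0 <= j < N) g j * D j.+1) @[N --> \oo] --> t.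

Let D_nd m n : (m <= n)%N -> D m <= D n.
Proof.
move=> mn; rewrite /D (@big_cat_nat _ _ _ m 0 n)//= lerDl.
by apply: sumr_ge0.
Qed.

Let D_ge1 j : 1 <= D j.+1.
Proof. by rewrite -d0 (_ : d 0 = D 1) ?D_nd// /D big_nat1. Qed.

(** The tail of the convergent series; it will bound the trace and the norm of what is left after
    [N] rank-one terms. *)
Definition weight_remainder N := t - \sum_(0 <= j < N) g j * D j.+1.

Definition weight_tail n := limn (fun N => \sum_(0 <= j < N) g j) - \sum_(0 <= j < n) g j.

Let sum_gD_nd : nondecreasing_seq (fun N => \sum_(0 <= j < N) g j * D j.+1).
Proof.
apply/nondecreasing_seqP => n; rewrite big_nat_recr//= lerDl mulr_ge0//.
exact: le_trans (D_ge1 n).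
Qed.

Let sum_gD_le N : \sum_(0 <= j < N) g j * D j.+1 <= t.
Proof.
rewrite -(cvg_lim _ gDt)//; apply: (nondecreasing_cvgn_le sum_gD_nd).
by apply/cvg_ex; exists t.
Qed.

Let sum_g_nd : nondecreasing_seq (fun N => \sum_(0 <= j < N) g j).
Proof. by apply/nondecreasing_seqP => n; rewrite big_nat_recr//= lerDl. Qed.

(** Normalising [d 0 = 1] gives [1 <= D j.+1], so the summable [g j * D j.+1] dominates [g j]. *)
Let sum_g_cvg : cvgn (fun N => \sum_(0 <= j < N) g j).
Proof.
apply: (@dominated_sum_cvg _ g (fun j => g j * D j.+1) t) => // n.
by rewrite ger0_norm// ler_peMr.
Qed.

Lemma weight_remainder_ge0 N : 0 <= weight_remainder N.
Proof. by rewrite subr_ge0. Qed.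

Lemma weight_remainder_cvg : weight_remainder N @[N --> \oo] --> 0.
Proof. by rewrite -(subrr t); apply: cvgB => //; exact: cvg_cst. Qed.

Lemma weight_tailS n : weight_tail n - weight_tail n.+1 = g n.
Proof. by rewrite /weight_tail big_nat_recr//=; ring. Qed.

Lemma weight_tail_ge0 n : 0 <= weight_tail n.
Proof. by rewrite subr_ge0; exact: nondecreasing_cvgn_le. Qed.

Lemma weight_tail_ni m n : (m <= n)%N -> weight_tail n <= weight_tail m.
Proof. by move=> mn; rewrite lerD2l lerN2; exact: sum_g_nd. Qed.

(** As [D] is nondecreasing, [D M] can be moved under the sum as [D j.+1]; this is done up to a
    finite [K] before passing to the limit. *)
Lemma weight_tail_le M : D M * weight_tail M <= weight_remainder M.
Proof.
have DM : 0 <= D M by exact: sumr_ge0.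
suff H K : (M <= K)%N ->
    D M * (\sum_(0 <= j < K) g j - \sum_(0 <= j < M) g j) <= weight_remainder M.
  have cv : (D M * (\sum_(0 <= j < K) g j - \sum_(0 <= j < M) g j)) @[K --> \oo]
      --> D M * weight_tail M.
    by apply: cvgMr; apply: cvgB; [exact: sum_g_cvg|exact: cvg_cst].
  rewrite -(cvg_lim _ cv)//; apply: limr_le; first by apply/cvg_ex; eexists; exact: cv.
  by exists M => // K /= /H.
move=> MK; apply: (@le_trans _ _ (\sum_(M <= j < K) g j * D j.+1)).
  rewrite (@big_cat_nat _ _ _ M 0 K)//= addrAC subrr add0r mulr_sumr.
  apply: ler_sum_nat => j /andP[Mj _].
  by rewrite mulrC ler_wpM2l// D_nd// (leq_trans Mj).
have := sum_gD_le K; rewrite (@big_cat_nat _ _ _ M 0 K)//= => h.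
by rewrite /weight_remainder lerBrDl.
Qed.

Lemma sum_weight_tail_le N M :
  \sum_(0 <= m < M) d m * weight_tail (maxn m N) <= weight_remainder N.
Proof.
(* Abel summation; the boundary term is absorbed by [weight_tail_le], and the bound that results is
   exactly [weight_remainder N]. *)
have F k : \sum_(0 <= m < N + k) d m * weight_tail (maxn m N) =
    \sum_(N <= j < N + k) g j * D j.+1 + D (N + k) * weight_tail (N + k).
  elim: k => [|k IH].
    rewrite addn0 [X in X + _]big_geq// add0r /D mulr_suml.
    rewrite big_nat_cond [RHS]big_nat_cond; apply: eq_bigr => m /andP[/andP[_ mN] _].
    by rewrite (maxn_idPr (ltnW mN)).
  rewrite addnS big_nat_recr//= IH [in RHS]big_nat_recr ?leq_addr//=.
  rewrite (maxn_idPl (leq_addr _ _)) -(weight_tailS (N + k)).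
  have -> : D (N + k).+1 = D (N + k) + d (N + k) by rewrite /D big_nat_recr.
  ring.
have H k : \sum_(0 <= m < N + k) d m * weight_tail (maxn m N) <= weight_remainder N.
  rewrite F; apply: le_trans (lerD (lexx _) (weight_tail_le _)) _.
  rewrite /weight_remainder (@big_cat_nat _ _ _ N 0 (N + k)) ?leq_addr//=.
  by rewrite le_eqVlt (_ : _ + _ == _)//; apply/eqP; ring.
apply: le_trans (H M); rewrite (@big_cat_nat _ _ _ M 0 (N + M)) ?leq_addl//= lerDl.
by apply: sumr_ge0 => i _; rewrite mulr_ge0// weight_tail_ge0.
Qed.

End TailSums.

(** * Kernels dominated by a rank-one kernel of finite trace *)

Section HilbertSchmidt.
Variable R : realType.
Local Notation cseq := (nat -> R[i]).
Local Notation rc := (real_complex R).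
Variables (K : nat -> nat -> R) (k : nat -> R) (t : R).
Hypothesis k_ge0 : forall m, 0 <= k m.
Hypothesis K_le : forall m n, K m n ^+ 2 <= k m * k n.
Hypothesis k_sum : forall M, \sum_(0 <= m < M) k m <= t.

Lemma kernel_row_l2 m :
  l2 (fun n => rc (K m n)) /\ sqnorm (fun n => rc (K m n)) <= k m * t.
Proof.
apply: l2_le => N; under eq_bigr do rewrite sqmodR.
apply: (@le_trans _ _ (\sum_(0 <= n < N) k m * k n)); first by apply: ler_sum.
by rewrite -mulr_sumr ler_wpM2l.
Qed.

(** Cauchy-Schwarz on row [m] gives [k m * t * sqnorm x]; summing over [m] gives the second factor
    [t]. *)
Lemma kernel_operator_bound (x : cseq) : l2 x ->
  l2 (fun m => inner (fun n => rc (K m n)) x) /\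
  sqnorm (fun m => inner (fun n => rc (K m n)) x) <= t ^+ 2 * sqnorm x.
Proof.
move=> lx; have t0 : 0 <= t by have := k_sum 0; rewrite big_geq.
have x0 := sqnorm_ge0 lx.
apply: l2_le => N.
apply: (@le_trans _ _ (\sum_(0 <= n < N) k n * (t * sqnorm x))).
  apply: ler_sum => m _; have [lK sK] := kernel_row_l2 m.
  apply: le_trans (sqmod_inner_le lK lx) _.
  by rewrite mulrA ler_wpM2r.
by rewrite -mulr_suml expr2 -mulrA ler_wpM2r// mulr_ge0.
Qed.

End HilbertSchmidt.

(** * Parseval's identity *)

Section Parseval.
Variable R : realType.
Local Notation cseq := (nat -> R[i]).
Variable f : nat -> cseq.
Hypothesis f_basis : orthonormal_basis f.

Let f_l2 n : l2 (f n). Proof. by case: f_basis. Qed.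
Let f_orth m n : inner (f m) (f n) = (m == n)%:R. Proof. by case: f_basis. Qed.

Let partial (x : cseq) N : cseq := fun k => \sum_(0 <= n < N) inner (f n) x * f n k.

Let partialS x N : partial x N.+1 = partial x N + scale_seq (inner (f N) x) (f N).
Proof. by apply/funext => k; rewrite /partial big_nat_recr. Qed.

Let l2_partial x N : l2 (partial x N).
Proof.
elim: N => [|N IH]; last first.
  by rewrite partialS; apply: l2D => //; exact: l2_scale_seq.
have [_ l0] := sqnorm0 R.
by rewrite (_ : partial x 0 = (fun=> 0))//; apply/funext => k; rewrite /partial big_geq.
Qed.

Let inner_partial x N n : (N <= n)%N -> inner (f n) (partial x N) = 0.
Proof.
elim: N => [_|N IH Nn].
  rewrite (_ : partial x 0 = scale_seq 0 (f 0)) ?innerZr ?mul0r//.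
  by apply/funext => k; rewrite /partial big_geq// /scale_seq mul0r.
rewrite partialS innerDr//; last exact: l2_scale_seq.
by rewrite IH ?(ltnW Nn)// innerZr// f_orth gtn_eqF// mulr0 addr0.
Qed.

(** The partial expansion is orthogonal to the next basis vector, so each step lowers the squared
    norm of the residual by one squared coefficient; the residual tends to 0 by completeness of the
    basis. *)
Lemma parseval x : l2 x ->
  (\sum_(0 <= n < N) sqmod (inner (f n) x)) @[N --> \oo] --> sqnorm x.
Proof.
move=> lx; have lr N : l2 (x - partial x N) by exact: l2B.
have E N : sqnorm (x - partial x N) = sqnorm x - \sum_(0 <= n < N) sqmod (inner (f n) x).
  elim: N => [|N IH].
    rewrite big_geq// subr0; congr sqnorm; apply/funext => k.
    by rewrite cseqD cseqN /partial big_geq// subr0.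
  rewrite big_nat_recr//= partialS opprD addrA.
  have lc : l2 (scale_seq (inner (f N) x) (f N)) by exact: l2_scale_seq.
  rewrite (sqnormD (lr N) (l2N lc)) sqnormN// sqnormZ// IH innerNr// innerZr//.
  have -> : inner (x - partial x N) (f N) = conjc (inner (f N) x).
    by rewrite -innerJ// innerBl// (innerJ (f_l2 N) (l2_partial x N)) inner_partial// conjc0 subr0.
  have -> : sqnorm (f N) = 1 by rewrite sqnorm_inner// f_orth eqxx.
  by rewrite cReN [_ * conjc _]mulrC cRe_conjM; ring.
have [_ _ /(_ _ lx) h] := f_basis.
have {h} /l2cvgP h : l2cvg (partial x) x by [].
have {}h := h (l2_partial x) lx.
have {}h : (norm2 (partial x N - x) * norm2 (partial x N - x)) @[N --> \oo] --> (0 : R).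
  by rewrite -[X in _ --> X](mulr0 0); exact: cvgM.
have -> : (fun N => \sum_(0 <= n < N) sqmod (inner (f n) x)) =
    (fun N => sqnorm x - norm2 (partial x N - x) * norm2 (partial x N - x)).
  apply/funext => N; rewrite -expr2 norm2_sq; last exact: l2B.
  have -> : partial x N - x = - (x - partial x N) by rewrite opprB.
  by rewrite sqnormN// E; ring.
by rewrite -[X in _ --> X]subr0; apply: cvgB => //; exact: cvg_cst.
Qed.

End Parseval.

(** * The Green operator, its inversion of the Jacobi operator and its trace *)

Section GreenOperator.
Variables (R : realType) (a b : nat -> R).
Local Notation cseq := (nat -> R[i]).
Local Notation Re := (@complex.Re R).
Local Notation rc := (real_complex R).
Local Notation J := (jacobi_action a b).
Local Notation Q := (jacobi_poly0 a b).
Local Notation gw := (green_weight a b).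
Implicit Types (x y z p q : cseq) (c : R[i]).

Hypothesis a_gt0 : forall n, 0 < a n.
Hypothesis Q_alt : forall n, Q n * Q n.+1 < 0.
Variable t : R.
Hypothesis gDt :
  (\sum_(0 <= j < N) gw j * \sum_(0 <= n < j.+1) Q n ^+ 2) @[N --> \oo] --> t.

Let gw_ge0 n : 0 <= gw n.
Proof. exact/ltW/green_weight_gt0. Qed.

Let Q2_ge0 n : 0 <= Q n ^+ 2.
Proof. exact: sqr_ge0. Qed.

Let Q20 : Q 0 ^+ 2 = 1.
Proof. by rewrite jacobi_poly0_0 expr1n. Qed.

Local Notation tail := (weight_tail gw).
Local Notation remainder := (weight_remainder gw (fun n => Q n ^+ 2) t).

Let tail_ge0 n : 0 <= tail n.
Proof. exact: (weight_tail_ge0 gw_ge0 Q2_ge0 Q20 gDt). Qed.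

Let tail_ni m n : (m <= n)%N -> tail n <= tail m.
Proof. exact: (weight_tail_ni gw_ge0). Qed.

Let remainder0 : remainder 0 = t.
Proof. by rewrite /weight_remainder big_geq// subr0. Qed.

(** The kernel of the sum of the rank-one terms of index at least [N]: the term [j] contributes when
    [m], [n] and [N] are all at most [j]. The case [N = 0] is the candidate inverse, larger [N] its
    remainders. *)
Definition green_kernel N m n : R := Q m * Q n * tail (maxn (maxn m n) N).

Local Notation row N m := (fun n => rc (green_kernel N m n)).

Definition green_operator N x : cseq := fun m => inner (row N m) x.

Let diag N m := Q m ^+ 2 * tail (maxn m N).

Let diag_ge0 N m : 0 <= diag N m.
Proof. exact: mulr_ge0. Qed.

Let kernel_le N m n : green_kernel N m n ^+ 2 <= diag N m * diag N n.
Proof.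
rewrite /green_kernel /diag !exprMn [leRHS]mulrACA.
apply: ler_wpM2l; first exact: mulr_ge0.
rewrite [leLHS]expr2.
apply: ler_pM => //; apply: tail_ni.
- by rewrite geq_max !leq_max leqnn /= leqnn !orbT.
- by rewrite geq_max !leq_max leqnn /= leqnn !orbT.
Qed.

Let diag_sum N M : \sum_(0 <= m < M) diag N m <= remainder N.
Proof. exact: (sum_weight_tail_le gw_ge0 Q2_ge0 Q20 gDt). Qed.

Let l2_row N m : l2 (row N m).
Proof. by have [] := kernel_row_l2 (diag_ge0 N) (kernel_le N) (diag_sum N) m. Qed.

Lemma l2_green_operator N x : l2 x -> l2 (green_operator N x).
Proof.
move=> lx.
by have [] := kernel_operator_bound (diag_ge0 N) (kernel_le N) (diag_sum N) lx.
Qed.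

Lemma sqnorm_green_operator N x : l2 x ->
  sqnorm (green_operator N x) <= remainder N ^+ 2 * sqnorm x.
Proof.
move=> lx.
by have [] := kernel_operator_bound (diag_ge0 N) (kernel_le N) (diag_sum N) lx.
Qed.

Lemma green_operator_linear N c x y : l2 x -> l2 y ->
  green_operator N (scale_seq c x + y) =
  scale_seq c (green_operator N x) + green_operator N y.
Proof.
move=> lx ly; apply/funext => m; rewrite cseqD /scale_seq /green_operator.
have lr := l2_row N m.
by rewrite -/(scale_seq c x) innerDr ?innerZr//; exact: l2_scale_seq.
Qed.

Definition Q_trunc j : cseq := trunc j.+1 (fun n => rc (Q n)).

Let l2_Q_trunc j : l2 (Q_trunc j). Proof. exact: l2_trunc. Qed.

Lemma sqnorm_Q_trunc j : sqnorm (Q_trunc j) = \sum_(0 <= n < j.+1) Q n ^+ 2.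
Proof. by rewrite sqnorm_trunc; apply: eq_bigr => n _; rewrite sqmodR. Qed.

(** The kernels for [N] and [N.+1] agree unless [m] and [n] are at most [N], and there the tails
    differ by [gw N]. *)
Lemma green_operatorS N x : l2 x -> green_operator N x =
  green_operator N.+1 x +
  scale_seq (rc (gw N) * inner (Q_trunc N) x) (Q_trunc N).
Proof.
move=> lx; apply/funext => m; rewrite cseqD /scale_seq /green_operator.
have lv : l2 (Q_trunc N) := l2_Q_trunc N.
have lr := l2_row N.+1 m.
have E : row N m = row N.+1 m + scale_seq (rc (gw N) * Q_trunc N m) (Q_trunc N).
  apply/funext => n; rewrite cseqD /scale_seq /Q_trunc /trunc /green_kernel !ltnS.
  have [mN|Nm] /= := leqP m N; last first.
    rewrite mulr0 mul0r addr0.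
    have Nmn : (N < maxn m n)%N by rewrite leq_max Nm.
    by rewrite (maxn_idPl (ltnW Nmn)) (maxn_idPl Nmn).
  have [nN|Nn] /= := leqP n N; last first.
    rewrite mulr0 addr0.
    have Nmn : (N < maxn m n)%N by rewrite leq_max Nn orbT.
    by rewrite (maxn_idPl (ltnW Nmn)) (maxn_idPl Nmn).
  have mnN : (maxn m n <= N)%N by rewrite geq_max mN.
  rewrite (maxn_idPr mnN) (maxn_idPr (leqW mnN)) -(weight_tailS gw N).
  rewrite -!rmorphM -rmorphD; congr rc; ring.
rewrite E innerDl//; last exact: l2_scale_seq.
rewrite innerZl// conjcM conjc_real; congr (_ + _).
have -> : conjc (Q_trunc N m) = Q_trunc N m.
  by rewrite /Q_trunc /trunc; case: ifP; rewrite ?conjc_real ?conjc0.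
ring.
Qed.

Lemma inner_green_operator N x : l2 x ->
  Re (inner x (green_operator 0 x)) =
  \sum_(0 <= j < N) gw j * sqmod (inner (Q_trunc j) x) +
  Re (inner x (green_operator N x)).
Proof.
move=> lx; pose q k := Re (inner x (green_operator k x)).
have qS k : q k = gw k * sqmod (inner (Q_trunc k) x) + q k.+1.
  have lg := l2_green_operator k.+1 lx; have lv := l2_Q_trunc k.
  have lc : l2 (scale_seq (rc (gw k) * inner (Q_trunc k) x) (Q_trunc k)) by exact: l2_scale_seq.
  rewrite /q (green_operatorS k lx) (innerDr lx lg lc).
  rewrite innerZr// (innerJ lv lx) cReD addrC; congr (_ + _).
  rewrite /sqmod; case: (inner _ _) => u v /=; ring.
suff : q 0 = \sum_(0 <= j < N) gw j * sqmod (inner (Q_trunc j) x) + q N by [].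
move: q qS => q qS; elim: N => [|N ->]; first by rewrite big_geq// add0r.
by rewrite big_nat_recr//= -addrA -qS.
Qed.

(** After [N] rank-one terms the error is the quadratic form of [green_operator N], whose norm is at
    most [remainder N]. *)
Lemma inner_green_operator_cvg x : l2 x ->
  (\sum_(0 <= j < N) gw j * sqmod (inner (Q_trunc j) x)) @[N --> \oo] -->
  Re (inner x (green_operator 0 x)).
Proof.
move=> lx.
have rem_ge0 N : 0 <= remainder N.
  exact: (weight_remainder_ge0 gw_ge0 Q2_ge0 Q20 gDt).
have rem_cvg : remainder N @[N --> \oo] --> 0 := weight_remainder_cvg gDt.
have -> : (fun N => \sum_(0 <= j < N) gw j * sqmod (inner (Q_trunc j) x)) =
    (fun N => Re (inner x (green_operator 0 x)) - Re (inner x (green_operator N x))).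
  have sub_sum (p q r : R) : p = q + r -> q = p - r by move=> ->; ring.
  by apply/funext => N; apply: sub_sum; exact: inner_green_operator.
rewrite -[X in _ --> X]subr0; apply: cvgB; first exact: cvg_cst.
have bd N : `|Re (inner x (green_operator N x))| <= remainder N * sqnorm x.
  have lg := l2_green_operator N lx.
  apply: le_trans (norm_Re_inner lx lg) _.
  rewrite -norm2_sq// expr2 mulrA mulrC ler_wpM2r ?norm2_ge0//.
  rewrite norm2_le ?mulr_ge0 ?norm2_ge0// exprMn norm2_sq//.
  exact: sqnorm_green_operator.
have rx0 : (remainder N * sqnorm x) @[N --> \oo] --> (0 : R).
  by rewrite -[X in _ --> X](mul0r (sqnorm x)); apply: cvgMl.
apply: (@squeeze_cvgr _ _ _ _ (fun N => - (remainder N * sqnorm x))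
  (fun N => remainder N * sqnorm x)) => //.
- by apply: nearW => N; rewrite -ler_norml.
- by rewrite -[X in _ --> X]oppr0; exact: cvgN.
Qed.

(** Column [n] of the kernel is [Q k] times [Q n * tail (maxn k n)], constant for [k <= n] and then
    decreasing by [Q n * gw k]: the increments that [jacobi_action_solution] requires for [delta n].
    As row [m] of [J] meets at most three rows of the kernel, [J] can be moved inside the inner
    product. *)
Lemma jacobi_green_operator x : l2 x -> J (green_operator 0 x) = x.
Proof.
move=> lx; apply/funext => m; rewrite jacobi_actionE.
have col n : J (fun k => rc (green_kernel 0 k n)) = delta R n.
  have -> : (fun k => rc (green_kernel 0 k n)) =
      (fun k => rc (Q k) * rc (Q n * tail (maxn k n))).
    by apply/funext => k; rewrite /green_kernel maxn0 -rmorphM mulrA.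
  apply: jacobi_action_solution => // k.
  rewrite -[LHS]/(rc (Q n * tail (maxn k n)) - rc (Q n * tail (maxn k.+1 n))).
  have -> : \sum_(0 <= i < k.+1) rc (Q i) * delta R n i =
      if (n <= k)%N then rc (Q n) else 0.
    rewrite big_mkord; case: leqP => [nk|kn].
      rewrite (bigD1 (inord n)) //= inordK ?ltnS// /delta eqxx mulr1 big1 ?addr0//.
      move=> i ni; suff -> : (i == n :> nat) = false by rewrite mulr0.
      by apply: contraNF ni => /eqP ni; apply/eqP/val_inj; rewrite /= inordK ?ltnS.
    rewrite big1// => i _; rewrite /delta ltn_eqF ?mulr0//.
    exact: leq_trans (ltn_ord i) kn.
  rewrite -rmorphB; case: leqP => [nk|kn].
    rewrite (maxn_idPl (leqW nk)) -rmorphM -mulrBr weight_tailS.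
    by rewrite mulrC.
  by rewrite (maxn_idPr kn) subrr mulr0.
have lr k : l2 (row 0 k) := l2_row 0 k.
(* The contribution of row [m - 1], empty for [m = 0]; a single vector for both cases lets the inner
   products be added uniformly. *)
pose prev : cseq := if m is k.+1 then scale_seq (rc (a k)) (row 0 k) else fun=> 0.
have lprev : l2 prev.
  rewrite /prev; case: (m) => [|k]; first by case: (sqnorm0 R).
  exact: l2_scale_seq.
have l1 : l2 (scale_seq (rc (a m)) (row 0 m.+1)) by exact: l2_scale_seq.
have l3 : l2 (scale_seq (rc (b m)) (row 0 m)) by exact: l2_scale_seq.
have -> : (if m is k.+1 then rc (a k) * green_operator 0 x k else 0) = inner prev x.
  rewrite /prev; case: (m) => [|k]; last by rewrite innerZl// conjc_real.
  by rewrite (inner_finite x (N := 0)) ?big_geq.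
rewrite /green_operator.
have -> : rc (a m) * inner (row 0 m.+1) x = inner (scale_seq (rc (a m)) (row 0 m.+1)) x.
  by rewrite innerZl// conjc_real.
have -> : rc (b m) * inner (row 0 m) x = inner (scale_seq (rc (b m)) (row 0 m)) x.
  by rewrite innerZl// conjc_real.
rewrite -!innerDl//; last exact: l2D.
rewrite -[RHS](inner_deltal m x); congr inner; apply/funext => n.
rewrite !cseqD /scale_seq; have := congr1 (@^~ m) (col n).
rewrite jacobi_actionE /delta eq_sym => <-; congr (_ + _).
by rewrite /prev; case: (m).
Qed.

Hypothesis Q_div : forall M, exists N, M <= \sum_(0 <= n < N) Q n ^+ 2.
Hypothesis J_psd : positive_semidefinite (jacobi_operator a b).

Lemma positive_semidefinite_nonneg : jacobi_nonneg a b.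
Proof.
by move=> x /(jacobi_operator_finite a b)/J_psd; rewrite lecE => /andP[].
Qed.

Lemma jacobi_operator_green x : l2 x -> jacobi_operator a b (green_operator 0 x, x).
Proof.
move=> lx; rewrite -{2}(jacobi_green_operator lx).
apply: jacobi_operator_maximal => //.
- exact: positive_semidefinite_nonneg.
- exact: l2_green_operator.
- by rewrite jacobi_green_operator.
Qed.

(** Any preimage of [x] differs from [green_operator 0 x] by a null vector in [l2], hence by 0. *)
Lemma jacobi_inverse_graph :
  graph_inverse (jacobi_operator a b) = graph_of (green_operator 0).
Proof.
apply/seteqP; split=> -[x y] /=.
- move=> Jyx; have [ly lx xE] := jacobi_operatorW Jyx; split=> //=.
  have lg := l2_green_operator 0 lx.
  apply/eqP; rewrite -subr_eq0; apply/eqP.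
  apply: (jacobi_kernel_l2 a_gt0 Q_div); first exact: l2B.
  by rewrite jacobi_actionB -xE jacobi_green_operator// subrr.
- by move=> [/= lx ->]; exact: jacobi_operator_green.
Qed.

Lemma bounded_green_operator : bounded_operator (green_operator 0).
Proof.
have t0 : 0 <= t by rewrite -remainder0; exact: (weight_remainder_ge0 gw_ge0 Q2_ge0 Q20 gDt).
split.
- by move=> x; exact: l2_green_operator.
- by move=> c x y lx ly; exact: green_operator_linear.
- exists t => x lx; have lg := l2_green_operator 0 lx.
  rewrite !l2normE// -EFinM lee_fin -!/(norm2 _).
  rewrite norm2_le ?mulr_ge0 ?norm2_ge0// exprMn norm2_sq//.
  by have := sqnorm_green_operator 0 lx; rewrite remainder0.
Qed.

(** Write [y] as the image of [green_operator 0 y] and move [J] to the other side. *)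
Lemma inner_green_operatorC x y : l2 x -> l2 y ->
  inner (green_operator 0 x) y = inner x (green_operator 0 y).
Proof.
move=> lx ly; have Jx := jacobi_operator_green lx; have Jy := jacobi_operator_green ly.
have lg := l2_green_operator 0 lx.
rewrite (jacobi_operator_adjoint lg _ Jy) jacobi_green_operator//.
Qed.

Lemma inner_green_operator_ge0 x : l2 x -> 0 <= inner x (green_operator 0 x).
Proof.
by move=> lx; rewrite -inner_green_operatorC//; exact/J_psd/jacobi_operator_green.
Qed.

Lemma green_operator_trace f : orthonormal_basis f ->
  (\sum_(0 <= n < N) Re (inner (f n) (green_operator 0 (f n)))) @[N --> \oo] --> t.
Proof.
move=> fb; have [lf _ _] := fb.
have Rege0 n : 0 <= Re (inner (f n) (green_operator 0 (f n))).
  by have := inner_green_operator_ge0 (lf n); rewrite lecE => /andP[].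
have E : (\sum_(0 <= n <oo) (Re (inner (f n) (green_operator 0 (f n))))%:E = t%:E)%E.
  transitivity (\sum_(0 <= n <oo) \sum_(0 <= j <oo)
      (gw j * sqmod (inner (Q_trunc j) (f n)))%:E)%E.
    apply: eq_eseriesr => n _; apply/esym/cvg_nneseries.
    exact: inner_green_operator_cvg.
  rewrite nneseries_interchange; last first.
    by move=> i j; rewrite lee_fin mulr_ge0// sqmod_ge0.
  rewrite -(cvg_nneseries gDt); apply: eq_eseriesr => j _.
  have lv := l2_Q_trunc j.
  apply: cvg_nneseries; rewrite -sqnorm_Q_trunc.
  under eq_fun do rewrite -mulr_sumr.
  apply: cvgMr; have := parseval fb lv.
  by under eq_fun do under eq_bigr do rewrite (innerJ lv (lf _)) sqmodJ.
rewrite -[X in _ --> X]/(fine t%:E) -E; apply: nneseries_cvg => //.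
by rewrite E ltry.
Qed.

(** Being positive and symmetric, the Green operator is its own adjoint and its own absolute
    value. *)
Lemma jacobi_inverse_trace_class : trace_class (graph_inverse (jacobi_operator a b)).
Proof.
exists (green_operator 0), (green_operator 0); split.
- exact: jacobi_inverse_graph.
- exact: bounded_green_operator.
- split; first exact: bounded_green_operator.
    exact: inner_green_operator_ge0.
  exists (green_operator 0) => //; split; first exact: bounded_green_operator.
  exact: inner_green_operatorC.
- by move=> f /green_operator_trace/cvg_nneseries ->; exact: ltry.
Qed.

Lemma jacobi_inverse_has_trace :
  has_trace (graph_inverse (jacobi_operator a b)) (rc t).
Proof.
exists (green_operator 0); split.
- exact: jacobi_inverse_graph.
- exact: bounded_green_operator.
move=> f fb; split; first exact: green_operator_trace.
have -> : (fun N => \sum_(0 <= n < N)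
    complex.Im (inner (f n) (green_operator 0 (f n)))) = (fun=> 0).
  apply/funext => N; apply: big1 => n _.
  have [lf _ _] := fb; have := inner_green_operator_ge0 (lf n).
  by rewrite lecE => /andP[/eqP].
exact: cvg_cst.
Qed.

End GreenOperator.

(** * Comparison of a positive operator with its absolute value *)

Section BoundedOperators.
Variable R : realType.
Local Notation cseq := (nat -> R[i]).
Local Notation Re := (@complex.Re R).
Local Notation Im := (@complex.Im R).
Local Notation rc := (real_complex R).
Implicit Types (x y z : cseq) (c : R[i]) (T A P : cseq -> cseq).

Lemma bounded_operatorP T : bounded_operator T <->
  [/\ forall x, l2 x -> l2 (T x),
      forall c x y, l2 x -> l2 y ->
        T (scale_seq c x + y) = scale_seq c (T x) + T y &
      exists2 M, 0 <= M & forall x, l2 x -> norm2 (T x) <= M * norm2 x].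
Proof.
split=> -[Tl2 Tlin [M]].
- move=> b; split=> //; exists `|M| => // x lx; have lTx := Tl2 x lx; have := b _ lx.
  rewrite !l2normE// -EFinM lee_fin => h; apply: le_trans h _.
  by rewrite ler_wpM2r ?norm2_ge0// ler_norm.
- move=> M0 bT; split=> //; exists M => x lx; have lTx := Tl2 x lx.
  by rewrite !l2normE// -EFinM lee_fin; exact: bT.
Qed.

Lemma bounded_operatorD T A : bounded_operator T -> bounded_operator A ->
  bounded_operator (fun x => T x + A x).
Proof.
move=> /bounded_operatorP[Tl Tlin [M M0 TM]] /bounded_operatorP[Al Alin [N N0 AN]].
apply/bounded_operatorP; split.
- by move=> x lx; apply: l2D; [exact: Tl|exact: Al].
- move=> c x y lx ly; rewrite Tlin// Alin//; apply/funext => n.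
  by rewrite !cseqD /scale_seq !cseqD; ring.
- exists (M + N); first exact: addr_ge0.
  move=> x lx; rewrite mulrDl; apply: le_trans (norm2D (Tl _ lx) (Al _ lx)) _.
  by apply: lerD; [exact: TM|exact: AN].
Qed.

Lemma bounded_operatorZ c T : bounded_operator T ->
  bounded_operator (fun x => scale_seq c (T x)).
Proof.
move=> /bounded_operatorP[Tl Tlin [M M0 TM]]; apply/bounded_operatorP; split.
- by move=> x lx; apply: l2_scale_seq; exact: Tl.
- move=> d x y lx ly; rewrite Tlin//; apply/funext => n.
  by rewrite !cseqD /scale_seq !cseqD; ring.
- exists (Num.sqrt (sqmod c) * M); first by rewrite mulr_ge0// sqrtr_ge0.
  move=> x lx; rewrite norm2Z; last exact: Tl.
  by rewrite -mulrA ler_wpM2l ?sqrtr_ge0// TM.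
Qed.

Lemma bounded_operator_id : bounded_operator (fun x => x).
Proof.
apply/bounded_operatorP; split=> //.
by exists 1 => // x lx; rewrite mul1r.
Qed.

(** Polarization: the imaginary part of the form at [i * x + y] vanishes, and its cross terms are
    the difference of the two real parts. *)
Lemma positive_operator_sym A : bounded_operator A ->
  (forall x, l2 x -> 0 <= inner x (A x)) ->
  forall x y, l2 x -> l2 y -> Re (inner x (A y)) = Re (inner y (A x)).
Proof.
move=> /bounded_operatorP[Al Alin _] A0 x y lx ly.
have A0' z : l2 z -> Im (inner z (A z)) = 0.
  by move=> lz; have := A0 z lz; rewrite lecE => /andP[/eqP].
pose i : R[i] := Complex 0 1.
have lix : l2 (scale_seq i x) by exact: l2_scale_seq.
have liAx : l2 (scale_seq i (A x)) by apply: l2_scale_seq; exact: Al.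
have [lAx lAy] := (Al x lx, Al y ly).
have := A0' _ (l2D lix ly); rewrite Alin// innerDl//; last exact: l2D.
rewrite !innerDr// !innerZl// !innerZr// !cReImE.
move: (A0' x lx) (A0' y ly).
case: (inner x (A x)) (inner y (A y)) => ? ? [? ?] /= -> ->.
case: (inner x (A y)) => p q; case: (inner y (A x)) => r s /=; lra.
Qed.

(* Cauchy-Schwarz for the semi-inner product [Re <y, P x>], taken at [y = P x]. *)
Lemma nonneg_operator_sqnorm P : bounded_operator P ->
  (forall x y, l2 x -> l2 y -> Re (inner x (P y)) = Re (inner y (P x))) ->
  (forall x, l2 x -> 0 <= Re (inner x (P x))) ->
  exists2 C, 0 <= C & forall x, l2 x -> sqnorm (P x) <= C * Re (inner x (P x)).
Proof.
move=> /bounded_operatorP[Pl Plin [M M0 PM]] Psym P0.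
have CS x y : l2 x -> l2 y ->
    Re (inner y (P x)) ^+ 2 <= Re (inner y (P y)) * Re (inner x (P x)).
  move=> lx ly; apply: quadratic_ge0_discr => [|s]; first exact: P0.
  have [lPx lPy] := (Pl x lx, Pl y ly).
  have ls : l2 (scale_seq (rc s) y) by exact: l2_scale_seq.
  have lPs : l2 (scale_seq (rc s) (P y)) by exact: l2_scale_seq.
  have := P0 _ (l2D ls lx); rewrite Plin// innerDl//; last exact: l2D.
  rewrite !innerDr// !innerZl// !innerZr// conjc_real !cReImE (Psym x y)//=.
  by congr (_ <= _); ring.
exists M => // x lx; have lPx := Pl x lx.
have := CS x (P x) lx lPx; rewrite -sqnorm_inner// => h.
have h2 : Re (inner (P x) (P (P x))) <= M * sqnorm (P x).
  apply: le_trans (ler_norm _) (le_trans (norm_Re_inner lPx (Pl _ lPx)) _).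
  rewrite -norm2_sq// expr2 mulrCA ler_wpM2l ?norm2_ge0//; exact: PM.
have {h2}h := le_trans h (ler_wpM2r (P0 x lx) h2).
have := sqnorm_ge0 lPx; rewrite le_eqVlt => /orP[/eqP<-|Px0].
  by rewrite mulr_ge0// P0.
by rewrite -(ler_pM2l Px0) -expr2 mulrCA mulrA.
Qed.

(* If [A - T] had a negative lower bound [- mu], approximate minimizers [x] of
   [<x, (A - T) x>] would satisfy [(A - T) x ~ - mu x], whereas
   [Re <(A + T) x, (A - T) x> = |A x|^2 - |T x|^2 = 0]; this forces
   [<x, (A + T) x> ~ 0], hence [mu = 0]. *)
Lemma positive_operator_le A T : bounded_operator A -> bounded_operator T ->
  (forall x, l2 x -> 0 <= inner x (A x)) ->
  (forall x, l2 x -> 0 <= inner x (T x)) ->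
  (forall x, l2 x -> sqnorm (A x) = sqnorm (T x)) ->
  forall x, l2 x -> Re (inner x (T x)) <= Re (inner x (A x)).
Proof.
move=> bA bT A0 T0 AT.
have Re_ge0 (c : R[i]) : 0 <= c -> 0 <= Re c by rewrite lecE => /andP[].
have Asym := positive_operator_sym bA A0; have Tsym := positive_operator_sym bT T0.
have [Al _ _] := bA; have [Tl _ _] := bT.
pose q x := Re (inner x (T x)) - Re (inner x (A x)).
have /bounded_operatorP[_ _ [M M0 bM]] := bT.
have q_le x : l2 x -> sqnorm x <= 1 -> q x <= M.
  move=> lx x1; rewrite lerBlDr; apply: le_trans (_ : M <= _); last first.
    by rewrite lerDl; exact/Re_ge0/A0.
  apply: le_trans (ler_norm _) (le_trans (norm_Re_inner lx (Tl _ lx)) _).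
  apply: le_trans (ler_wpM2l (norm2_ge0 x) (bM _ lx)) _.
  by rewrite mulrCA -expr2 norm2_sq// ler_piMr.
(* The supremum is over the unit ball rather than the sphere, so that 0 belongs to it and [mu] is
   nonnegative. *)
pose E := [set r | exists2 x, l2 x /\ sqnorm x <= 1 & r = q x].
have q0 : q (fun=> 0) = 0.
  rewrite /q !(inner_finite _ (N := 0) (fun _ _ => erefl)) !big_geq//; exact: subrr.
have supE : has_sup E.
  split; first by exists (q (fun=> 0)), (fun=> 0) => //; have [-> ?] := sqnorm0 R; rewrite ler01.
  by exists M => r [x [lx x1] ->]; exact: q_le.
pose mu := sup E.
have mu0 : 0 <= mu.
  apply: (ub_le_sup supE.2); exists (fun=> 0); last by rewrite q0.
  by have [-> ?] := sqnorm0 R; rewrite ler01.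
have q_mu x : l2 x -> q x <= mu * sqnorm x.
  move=> lx; have := sqnorm_ge0 lx; rewrite le_eqVlt => /orP[/eqP/esym x0|x0].
    by rewrite x0 mulr0 (sqnorm_eq0 lx x0) q0.
  pose r := (norm2 x)^-1; pose y := scale_seq (rc r) x.
  have nx : 0 < norm2 x by rewrite sqrtr_gt0.
  have ly : l2 y by exact: l2_scale_seq.
  have r2 : r ^+ 2 = (sqnorm x)^-1 by rewrite /r exprVn norm2_sq.
  have y1 : sqnorm y <= 1 by rewrite sqnormZ// sqmodR r2 mulVf ?gt_eqF.
  have qy : q y = r ^+ 2 * q x.
    have lin U : bounded_operator U -> U y = scale_seq (rc r) (U x).
      move=> /bounded_operatorP[Ul Ulin _].
      have [_ l0] := sqnorm0 R.
      have U0 : U (fun=> 0) = (fun=> 0).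
        by have := Ulin (-1) _ _ l0 l0; rewrite !scale_seqN1 !addNr.
      have := Ulin (rc r) x _ lx l0; rewrite U0.
      have E0 z : z + (fun=> 0) = z by apply/funext => n; rewrite cseqD addr0.
      by rewrite !E0.
    have scaled U : bounded_operator U -> Re (inner y (U y)) = r ^+ 2 * Re (inner x (U x)).
      move=> bU; have [Ul _ _] := bU; have lUx := Ul x lx.
      rewrite (lin _ bU) (innerZr _ ly lUx) (innerZl _ lx lUx) conjc_real !cReImE /=; ring.
    by rewrite /q (scaled _ bT) (scaled _ bA) mulrBr.
  have : q y <= mu by apply: (ub_le_sup supE.2); exists y.
  by rewrite qy r2 mulrC ler_pdivrMr.
suff mu_eq0 : mu = 0.
  by move=> x lx; have := q_mu x lx; rewrite mu_eq0 mul0r subr_le0.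
apply/eqP; rewrite eq_le mu0 andbT leNgt; apply/negP => mu_gt0.
pose P x := (A x + scale_seq (-1) (T x)) + scale_seq (rc mu) x.
have bP : bounded_operator P.
  apply: (bounded_operatorD (bounded_operatorD bA (bounded_operatorZ (-1) bT))).
  exact: bounded_operatorZ bounded_operator_id.
have PE x y : l2 x -> l2 y -> Re (inner x (P y)) =
    Re (inner x (A y)) - Re (inner x (T y)) + mu * Re (inner x y).
  move=> lx ly; have [lAy lTy] := (Al y ly, Tl y ly).
  have lm : l2 (scale_seq (rc mu) y) by exact: l2_scale_seq.
  rewrite /P scale_seqN1 innerDr//; last by apply: l2B.
  by rewrite innerBr// innerZr// !cReImE/=; ring.
have Psym x y : l2 x -> l2 y -> Re (inner x (P y)) = Re (inner y (P x)).
  move=> lx ly; rewrite (PE x y lx ly) (PE y x ly lx).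
  by rewrite (Asym x y lx ly) (Tsym x y lx ly) (innerJ ly lx) cReJ.
have P0 x : l2 x -> 0 <= Re (inner x (P x)).
  by move=> lx; have := q_mu x lx; rewrite PE// /q -sqnorm_inner//; lra.
have [C C0 PC] := nonneg_operator_sqnorm bP Psym P0.
have /bounded_operatorP[Sl _ [N N0 SN]] := bounded_operatorD bA bT.
pose L := N ^+ 2 * C.
have L0 : 0 <= L by rewrite mulr_ge0// sqr_ge0.
(* For an [e]-maximizer [x] of [q], the form of [A + T] at [x] is at least [q x], hence at least
   [mu / 2]. *)
have H e : 0 < e -> e <= mu / 2 -> (mu * (mu / 2)) ^+ 2 <= L * e.
  move=> e0 emu; have [_ [x [lx x1] ->] xe] := sup_adherent e0 supE.
  have [lAx lTx lSx] := And3 (Al x lx) (Tl x lx) (Sl x lx).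
  have [lP _ _] := bP; have lPx := lP x lx.
  have qxS : q x <= Re (inner x (A x + T x)).
    rewrite innerDr// cReD /q.
    have := Re_ge0 _ (A0 x lx); lra.
  have PxE : Re (inner x (P x)) <= e.
    rewrite PE// -sqnorm_inner//.
    have : mu * sqnorm x <= mu by rewrite ler_piMr.
    move: xe; rewrite /q -/mu; lra.
  have Px : sqnorm (P x) <= C * e by apply: le_trans (PC x lx) _; rewrite ler_wpM2l.
  have Sx : sqnorm (A x + T x) <= N ^+ 2.
    rewrite -norm2_sq//; apply: (@le_trans _ _ ((N * norm2 x) ^+ 2)).
      by rewrite ler_sqr ?nnegrE ?mulr_ge0 ?norm2_ge0// SN.
    by rewrite exprMn norm2_sq// ler_piMr// sqr_ge0.
  have SD : Re (inner (A x + T x) (P x)) = mu * Re (inner x (A x + T x)).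
    rewrite (PE _ _ lSx lx) (innerDl lAx lTx lAx) (innerDl lAx lTx lTx).
    rewrite (innerJ lAx lTx) (innerJ lx lSx) !cReD !cReJ.
    by rewrite -(sqnorm_inner lAx) -(sqnorm_inner lTx) (AT x lx); ring.
  have := Re_inner_le lSx lPx; rewrite SD => h.
  apply: (@le_trans _ _ ((mu * Re (inner x (A x + T x))) ^+ 2)).
    have hS : mu / 2 <= Re (inner x (A x + T x)).
      by apply: le_trans qxS; move: xe; rewrite -/mu; lra.
    rewrite ler_sqr ?nnegrE ?mulr_ge0 ?divr_ge0 ?ler_wpM2l//.
    by apply: le_trans hS; rewrite divr_ge0.
  apply: le_trans h _; rewrite /L -mulrA.
  by apply: ler_pM => //; exact: sqnorm_ge0.
have D0 : 0 < (mu * (mu / 2)) ^+ 2 by rewrite exprn_gt0// mulr_gt0// divr_gt0.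
set d := (mu * (mu / 2)) ^+ 2 in H D0.
have L1 : 0 < L + 1 by rewrite ltr_wpDl.
(* The second bound gives [L * e <= d / 2], against [d <= L * e] from [H]. *)
pose e := Num.min (mu / 2) (d / (2 * (L + 1))).
have e0 : 0 < e by rewrite lt_min !divr_gt0// mulr_gt0.
have := H e e0; rewrite ge_min lexx /= => /(_ isT) h.
have : e <= d / (2 * (L + 1)) by rewrite ge_min lexx orbT.
move=> /(ler_wpM2l (ltW L1)).
have -> : (L + 1) * (d / (2 * (L + 1))) = d / 2 by field; rewrite gt_eqF.
move: h e0 D0; rewrite mulrDl mul1r; lra.
Qed.

Lemma delta_orthonormal_basis : orthonormal_basis (@delta R).
Proof.
split=> [n|m n|x lx]; first exact: l2_delta.
  by rewrite inner_deltal.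
have -> : (fun N k => \sum_(0 <= n < N) inner (delta R n) x * delta R n k) =
    (fun N => trunc N x); last exact: trunc_cvg.
apply/funext => N; apply/funext => k; rewrite /trunc.
under eq_bigr do rewrite inner_deltal.
elim: N => [|N IH]; first by rewrite big_geq.
rewrite big_nat_recr//= IH /delta [in RHS]ltnS [in RHS]leq_eqVlt; case: eqVneq => [->|].
  by rewrite ltnn /= add0r mulr1.
by rewrite mulr0 addr0.
Qed.

End BoundedOperators.

(** * From a trace-class inverse to convergence of the series *)

Section InverseTrace.
Variables (R : realType) (a b : nat -> R).
Local Notation cseq := (nat -> R[i]).
Local Notation Re := (@complex.Re R).
Local Notation rc := (real_complex R).
Local Notation J := (jacobi_action a b).
Local Notation Q := (jacobi_poly0 a b).
Local Notation gw := (green_weight a b).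
Implicit Types (x y z : cseq) (c : R[i]).

Hypothesis a_gt0 : forall n, 0 < a n.
Hypothesis J_psd : positive_semidefinite (jacobi_operator a b).
Hypothesis Q_div : forall M, exists N, M <= \sum_(0 <= n < N) Q n ^+ 2.

Let J_nonneg : jacobi_nonneg a b.
Proof. exact: positive_semidefinite_nonneg. Qed.

Let Q_alt : forall n, Q n * Q n.+1 < 0.
Proof. exact: jacobi_poly0_alt. Qed.

Let gw_ge0 n : 0 <= gw n.
Proof. exact/ltW/green_weight_gt0. Qed.

(** Each inner summand is [- gw j], and the outer sign cancels this one; nonnegativity of the
    weights lets negation pass through the extended sums. *)
Lemma inverse_trace_seriesE : inverse_trace_series a b =
  (\sum_(0 <= n <oo) ((\sum_(n <= j <oo) (gw j)%:E) * (Q n ^+ 2)%:E))%E.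
Proof.
have C0 n : (0 <= \sum_(n <= j <oo) (gw j)%:E)%E.
  by apply: nneseries_ge0 => *; rewrite lee_fin.
rewrite /inverse_trace_series; under eq_eseriesr => n _.
  under eq_eseriesr => j _.
    rewrite (_ : _%:E = - (gw j)%:E)%E; last by rewrite -EFinN /gw opprK div1r.
    over.
  rewrite nneseries_oppe; last by move=> j; rewrite lee_fin.
  rewrite mulNe; over.
rewrite nneseries_oppe ?oppeK// => n.
by rewrite mule_ge0// lee_fin sqr_ge0.
Qed.

(* With [g := J^-1 (delta n)] and [u] the truncated Green column, [J (g - u)] is
   a multiple of [delta N], so [0 <= <g - u, J (g - u)> = Re (g n) - u n]. *)
Lemma partial_green_le g n N : jacobi_operator a b (g, delta R n) -> (n < N)%N ->
  Q n ^+ 2 * \sum_(n <= j < N) gw j <= Re (g n).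
Proof.
move=> Jg nN; have [lg ld dE] := jacobi_operatorW Jg.
have Qn0 k : Q k != 0 := jacobi_poly0_neq0 Q_alt k.
pose h k := rc (Q n * \sum_(maxn k n <= j < N) gw j).
pose u : cseq := fun k => rc (Q k) * h k.
(* The multiple of [delta N] that cancels the moment of [delta n] against [Q], which allows [u] to
   vanish from [N] on. *)
pose r := rc (Q n / Q N).
have Ju : J u = delta R n - scale_seq r (delta R N).
  apply: jacobi_action_solution => // k; rewrite /h -rmorphB.
  have dsum i (c : R[i]) : \sum_(0 <= l < k.+1) rc (Q l) * (c * delta R i l) =
      if (i <= k)%N then c * rc (Q i) else 0.
    rewrite big_mkord; case: leqP => [ik|ki].
      rewrite (bigD1 (inord i)) //= inordK ?ltnS// /delta eqxx mulr1 mulrC big1 ?addr0//.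
      move=> l li; suff -> : (l == i :> nat) = false by rewrite !mulr0.
      by apply: contraNF li => /eqP li; apply/eqP/val_inj; rewrite /= inordK ?ltnS.
    rewrite big1// => l _; rewrite /delta ltn_eqF ?mulr0//.
    exact: leq_trans (ltn_ord l) ki.
  have -> : \sum_(0 <= l < k.+1) rc (Q l) * (delta R n - scale_seq r (delta R N)) l =
     \sum_(0 <= l < k.+1) rc (Q l) * (1 * delta R n l) -
     \sum_(0 <= l < k.+1) rc (Q l) * (r * delta R N l).
    by rewrite -sumrB; apply: eq_bigr => l _; rewrite cseqD cseqN /scale_seq mul1r mulrBr.
  rewrite !dsum mul1r /r -rmorphM divfK//.
  have [nk|kn] := leqP n k; last first.
    rewrite (maxn_idPr kn) subrr rmorph0.
    by rewrite leqNgt (ltn_trans kn nN) subr0 mulr0.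
  rewrite (maxn_idPl (leqW nk)).
  have [Nk|kN] := leqP N k; first by rewrite !big_geq ?subrr ?rmorph0 ?mulr0 ?leqW.
  rewrite subr0 -rmorphM; congr rc.
  by rewrite (big_ltn kN); ring.
have u0 k : (N <= k)%N -> u k = 0.
  move=> Nk; rewrite /u /h big_geq ?mulr0 ?rmorph0 ?mulr0//.
  by rewrite (leq_trans Nk) ?leq_maxl.
have fu : finitely_supported u by exists N.
have lu := l2_finitely_supported fu.
have lr : l2 (scale_seq r (delta R N)) by apply: l2_scale_seq; exact: l2_delta.
have JE : J (g - u) = scale_seq r (delta R N).
  by rewrite jacobi_actionB Ju -dE opprB addrC subrK.
have lgu := l2B lg lu.
have Jgu : jacobi_operator a b (g - u, scale_seq r (delta R N)).
  by rewrite -JE; apply: jacobi_operator_maximal => //; rewrite JE.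
have := J_psd Jgu; rewrite innerBl//.
have -> : inner u (scale_seq r (delta R N)) = 0.
  rewrite innerZr//; last exact: l2_delta.
  by rewrite inner_deltar// u0// conjc0 mulr0.
(* The pairing with [g] is expanded in this form because [J g = delta n] turns [inner g (J u)] into
   [u n]. *)
have -> : scale_seq r (delta R N) = delta R n - J u by rewrite Ju opprB addrC subrK.
have lJu : l2 (J u) by rewrite Ju; exact: l2B.
rewrite innerBr// inner_deltar// inner_jacobi_action// -?dE// inner_deltal subr0.
rewrite lecE => /andP[_]; rewrite !cReImE /= subr_ge0 /u /h.
by rewrite maxnn /= mul0r subr0 mulrA -expr2.
Qed.

Lemma inverse_trace_class_series : trace_class (graph_inverse (jacobi_operator a b)) ->
  (inverse_trace_series a b < +oo)%E.
Proof.
move=> [T [A [GT bT [bA A0 [T' [bT' adjT] AA]] trA]]].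
have JT x : l2 x -> jacobi_operator a b (T x, x).
  move=> lx; have : graph_of T (x, T x) by split.
  by rewrite -GT.
have [Tl _ _] := bT; have [Al _ _] := bA.
have T0 x : l2 x -> 0 <= inner x (T x).
  move=> lx; have := J_psd (JT x lx).
  by rewrite (innerJ lx (Tl x lx)) conj_ge0.
(* Both sides are the real part of the form of [A] squared, equal to the adjoint of [T] composed
   with [T]. *)
have AT x : l2 x -> sqnorm (A x) = sqnorm (T x).
  move=> lx; have [lAx lTx] := (Al x lx, Tl x lx).
  rewrite (sqnorm_inner lAx) (sqnorm_inner lTx).
  rewrite -(positive_operator_sym bA A0 lx lAx) AA//.
  have [T'l _ _] := bT'; have lT' := T'l _ lTx.
  by rewrite (innerJ lT' lx) cReJ adjT.
have TA := positive_operator_le bA bT A0 T0 AT.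
apply: le_lt_trans (trA _ (@delta_orthonormal_basis R)).
rewrite inverse_trace_seriesE; apply: lee_nneseries => [n _|n _].
  rewrite mule_ge0 ?lee_fin ?sqr_ge0//.
  by apply: nneseries_ge0 => *; rewrite lee_fin.
have ld := l2_delta R n.
rewrite muleC -nneseriesZl; last by move=> j _; rewrite lee_fin.
apply: lime_le.
  by apply: is_cvg_nneseries => *; rewrite -EFinM lee_fin mulr_ge0// sqr_ge0.
exists n.+1 => // N /= nN.
under eq_bigr do rewrite -EFinM.
rewrite sumEFin lee_fin -mulr_sumr; apply: le_trans (TA _ ld).
rewrite inner_deltal; exact: partial_green_le (JT _ ld) nN.
Qed.

(** Exchanging the sums yields the convergence assumed in the construction of the Green operator,
    with the value of the series as its limit. *)
Lemma inverse_trace_series_fin : (inverse_trace_series a b < +oo)%E ->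
  exists2 t, inverse_trace_series a b = t%:E &
    (\sum_(0 <= j < N) gw j * \sum_(0 <= n < j.+1) Q n ^+ 2) @[N --> \oo] --> t.
Proof.
have Q2 n : 0 <= Q n ^+ 2 by exact: sqr_ge0.
rewrite inverse_trace_seriesE nneseries_tail_weight// => h.
have gD0 j : 0 <= gw j * \sum_(0 <= n < j.+1) Q n ^+ 2.
  by apply: mulr_ge0 => //; exact: sumr_ge0.
have := nneseries_cvg gD0 h; set t := fine _ => ht; exists t => //.
exact: cvg_nneseries.
Qed.

End InverseTrace.

Unset Implicit Arguments.

Theorem theorem2p1 (R : realType) (a b : nat -> R)
  (a_gt0 : forall n, 0 < a n)
  (P_div : (\sum_(0 <= n <oo) (jacobi_poly0 a b n ^+ 2)%:E = +oo)%E)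
  (J_psd : positive_semidefinite (jacobi_operator a b)) :
  [/\ self_adjoint (jacobi_operator a b),
      invertible (jacobi_operator a b),
      trace_class (graph_inverse (jacobi_operator a b)) <->
        (inverse_trace_series a b < +oo)%E &
      trace_class (graph_inverse (jacobi_operator a b)) ->
        exists2 t : R, inverse_trace_series a b = t%:E &
          has_trace (graph_inverse (jacobi_operator a b)) (real_complex R t)].
Proof.
have Q_div M : exists N, M <= \sum_(0 <= n < N) jacobi_poly0 a b n ^+ 2.
  apply: contrapT => /forallNP h.
  suff : (\sum_(0 <= n <oo) (jacobi_poly0 a b n ^+ 2)%:E <= M%:E)%E by rewrite P_div.
  apply: lime_le; first by apply: is_cvg_nneseries => *; rewrite lee_fin sqr_ge0.
  by apply: nearW => N /=; rewrite sumEFin lee_fin ltW// ltNge; exact/negP.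
have J_nonneg := positive_semidefinite_nonneg J_psd.
have Q_alt := jacobi_poly0_alt a_gt0 J_nonneg.
have tc_series := inverse_trace_class_series a_gt0 J_psd Q_div.
split.
- exact: jacobi_operator_self_adjoint.
- exact: jacobi_operator_invertible.
- split=> // /(inverse_trace_series_fin a_gt0 J_psd)[t _ ht].
  exact: (jacobi_inverse_trace_class a_gt0 Q_alt ht Q_div J_psd).
- move=> /tc_series/(inverse_trace_series_fin a_gt0 J_psd)[t tE ht]; exists t => //.
  exact: (jacobi_inverse_has_trace a_gt0 Q_alt ht Q_div J_psd).
Qed.
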